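(* Assume that: 1. The set $\Omega$ and the function $q$ are such that for every $x_s(0)\in\Omega$ there exists a piecewise continuous control $u_s:[0,\delta]\to U$ such that the trajectory $x_s$ of $\dot x=f(x,u)$ generated by this control remains in $\Omega$ and satisfies $\frac{d}{d\tau}q(x_s(\tau))+L(x_s(\tau),u_s(\tau))\le0$ for $\tau\in[0,\delta]$. 2. The problem $P(0,x_0)$ has a solution. Then the closed-loop trajectory $x^*(t)$ generated by the quasi time optimal receding horizon algorithm described in the context converges asymptotically to zero, i.e. $\lim_{t\to\infty}x^*(t)=0$.
   Context: Notation: $\|x\|_H=\sqrt{x^THx}$ for a symmetric positive definite matrix $H$. A function $\varphi:[0,\infty)\to[0,\infty)$ is of class $\mathcal K$ if it is continuous, strictly increasing and $\varphi(0)=0$. System: $\dot x(t)=f(x(t),u(t))$, $x(0)=x_0$, $t\ge 0$, where $f:\mathbb R^n\times\mathbb R^m\to\mathbb R^n$ is $C^1$ in both arguments, $f(0,0)=0$, and $f$ is Lipschitz in $x$ on $\mathbb R^n$ with a constant independent of $u$. Controls take values in $U=\{u\in\mathbb R^m: u_{\min}\le u\le u_{\max}\}$, where $u_{\min}<0<u_{\max}$ (componentwise). $\Omega\subset\mathbb R^n$ is a closed, bounded, simply connected set with $0\in\Omega$. Numbers $T_{\min}\ge\delta>0$ are fixed; $\delta$ is the sampling time, and $t_i=i\delta$. A control $u:[t,t+T]\to\mathbb R^m$ is admissible in the point $x_t$ if it is piecewise continuous, $u(s)\in U$ on $[t,t+T]$, and the solution of the system with control $u$ and initial condition $x(t)=x_t$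 satisfies $x(t+T)\in\Omega$. The system is assumed asymptotically controllable: for every $x_0\in\mathbb R^n$ and $\eta>0$ there is an admissible control $u^D:[0,T_D]\to U$, $T_D<\infty$, steering $x_0$ to a point of norm less than $\eta$ at time $T_D$. Problem $P(t_i,x_{t_i})$ (with weights $\varepsilon_i\in[0,1]$, $\rho_i\ge1$): find a final time $T\ge T_{\min}$ and a control $u:[t_i,t_i+T]\to U$ admissible in $x_{t_i}$ minimizing $$J(u,T;x_{t_i})=T+\varepsilon_i\int_{t_i}^{t_i+T}L(x(s),u(s))\,ds+\rho_i\,q(x(t_i+T)),$$ where $x$ solves the system with control $u$ and initial condition $x(t_i)=x_{t_i}$. Here $L:\mathbb R^n\times\mathbb R^m\to[0,\infty)$ is $C^1$, $L(0,0)=0$, $L(x,u)\ge\alpha_L(\|x\|)$ with $\alpha_L\in\mathcal K$; $q:\mathbb R^n\to[0,\infty)$ is $C^1$, $q(0)=0$, $q(x)\ge c\|x\|_H^2$ for some constant $c>0$. It is assumed that solutions exist for initial states in all of $\mathbb R^n$ or in a sufficiently large set $X\supset\Omega$ (containing the states at which the problem is posed). A solution is denoted $\bar u^i,\overline T_i$, the corresponding trajectory on $[t_i,t_i+\overline T_i]$ is $\bar x^i$, and the optimal value is $V(x_{t_i})=J(\bar u^i,\overline T_i;x_{t_i})$. Algorithm. Given: the system function $f$, the control set $U$, the set $\Omega$, the numbers $T_{\min}\ge\delta>0$, the functions $L$ and $q$ defining the cost $J$, and the matrix $H$ and constant $c>0$ with $q(x)\ge c\|x\|_H^2$; a simply connected,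 closed and bounded set $\mathbf B\subset\mathbb R^n$ with $0\in\mathbf B$; a number $\alpha>0$ such that $c\|x\|_H^2\le\alpha$ implies $x\in\Omega$; $\xi\in(0,1)$; a number $\gamma>1$; an initial $\rho\ge1$. The weight $\rho_i$ in $P(t_i,x_{t_i})$ is the current value of $\rho$. Set $i=0$, $t_0=0$, $\varepsilon_0=0$. Step 1. Measure the state $x_{t_i}$. Step 2. Solve $P(t_i,x_{t_i})$. Step 2a. If $V(x_{t_i})/(\rho c)>\alpha$, replace $\rho$ by $\gamma\rho$ and go to Step 2. Step 2b. If $\overline T_i=T_{\min}$ and $\varepsilon_i=0$, choose $\varepsilon_i\in(0,1)$ and go to Step 2. Step 3. Apply $\bar u^i$ on $[t_i,t_i+\delta)$. Step 4. Measure the new state $x_{t_{i+1}}$, $t_{i+1}=t_i+\delta$. Step 5. Set $\varepsilon_{i+1}=\min(\varepsilon_i+\Delta\bar\varepsilon_i,1)$ if the newly measured state $x_{t_{i+1}}$ lies in $\mathbf B$, and $\varepsilon_{i+1}=\varepsilon_i$ otherwise, where $$\Delta\bar\varepsilon_i=(1-\xi)\frac{\delta+\varepsilon_i\int_{t_i}^{t_i+\delta}L(\bar x^i,\bar u^i)\,dt}{\int_{t_i+\delta}^{t_i+\overline T_i}L(\bar x^i,\bar u^i)\,dt}\quad\text{if }\overline T_i\ge T_{\min}+\delta,$$ $$\Delta\bar\varepsilon_i=(1-\xi)\frac{(\overline T_i-T_{\min})+\varepsilon_i\int_{t_i}^{t_i+\delta}L(\bar x^i,\bar u^i)\,ds}{\int_{t_i+\delta}^{t_i+\overline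 T_i}L(\bar x^i,\bar u^i)\,ds+q(\bar x^i(t_i+\overline T_i))}\quad\text{if }\overline T_i\in[T_{\min},T_{\min}+\delta).$$ Step 6. Increase $i$ by one and go to Step 2. The closed-loop trajectory $x^*$ is the concatenation of the trajectories $\bar x^i$ restricted to $[t_i,t_{i+1})$, with $x^*(0)=x_0$. *)

(* Defs.v *)
From HB Require Import structures.
From mathcomp Require Import all_boot all_order all_algebra.
From mathcomp Require Import all_classical all_reals all_analysis.

Set Implicit Arguments.
Unset Strict Implicit.
Unset Printing Implicit Defensive.

Import Order.TTheory GRing.Theory Num.Theory.
Import numFieldNormedType.Exports.

Local Open Scope classical_set_scope.
Local Open Scope ring_scope.

Definition spd (R : realType) (n : nat) (H : 'M[R]_n) : Prop :=
  H^T = H /\ forall x : 'cV[R]_n, x != 0 -> 0 < (x^T *m H *m x) 0 0.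

Definition normH (R : realType) (n : nat) (H : 'M[R]_n) (x : 'cV[R]_n) : R :=
  Num.sqrt ((x^T *m H *m x) 0 0).

(* Euclidean norm; the library norm `|x| on 'cV[R]_n is the max norm. *)
Definition enorm (R : realType) (n : nat) (x : 'cV[R]_n) : R := normH 1%:M x.

(* Only the values of phi on [0, +oo) matter. *)
Definition class_K (R : realType) (phi : R -> R) : Prop :=
  [/\ {within `[0, +oo[, continuous phi},
      {in `[0, +oo[ &, {homo phi : r s / r < s}} & phi 0 = 0].

(* In finite dimension, pointwise continuity of z |-> 'd g z is continuity
   for the operator norm. *)
Definition C1 (R : realType) (V W : normedModType R) (g : V -> W) : Prop :=
  (forall z, differentiable g z) /\ forall v, continuous (fun z => 'd g z v).

Definition simply_connected (R : realType) (V : normedModType R) (A : set V) :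
    Prop :=
  A !=set0 /\
  (forall x y, A x -> A y -> exists g : R -> V,
     [/\ {within `[0, 1], continuous g}, g @` `[0, 1] `<=` A, g 0 = x
       & g 1 = y]) /\
  (forall g : R -> V, {within `[0, 1], continuous g} ->
     g @` `[0, 1] `<=` A -> g 0 = g 1 ->
     exists h : R * R -> V,
       [/\ {within `[0, 1] `*` `[0, 1], continuous h},
           h @` (`[0, 1] `*` `[0, 1]) `<=` A,
           forall s, s \in `[0, 1] -> h (s, 0) = g s,
           forall s, s \in `[0, 1] -> h (s, 1) = g 0
         & forall t, t \in `[0, 1] -> h (0, t) = g 0 /\ h (1, t) = g 0]).

(* Finitely many discontinuities in (a, b), and finite one-sided limits
   everywhere on [a, b]. *)
Definition piecewise_continuous (R : realType) (W : normedModType R)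
    (a b : R) (u : R -> W) : Prop :=
  [/\ exists s : seq R,
        forall t, t \in `]a, b[ -> t \notin s -> {for t, continuous u},
      forall t, t \in `[a, b[ -> cvg (u @ t^'+)
    & forall t, t \in `]a, b] -> cvg (u @ t^'-)].

(* Solutions for piecewise continuous controls: continuous, and the
   differential equation holds outside a finite set of times. *)
Definition trajectory (R : realType) (n m : nat)
    (f : 'cV[R]_n * 'cV[R]_m -> 'cV[R]_n) (a b : R)
    (u : R -> 'cV[R]_m) (x : R -> 'cV[R]_n) : Prop :=
  {within `[a, b], continuous x} /\
  exists s : seq R, forall t, t \in `]a, b[ -> t \notin s ->
    is_derive t 1 x (f (x t, u t)).

Record problem (R : realType) (n m : nat) := Problem {
  dyn : 'cV[R]_n * 'cV[R]_m -> 'cV[R]_n;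
  umin : 'cV[R]_m;
  umax : 'cV[R]_m;
  Omega : set 'cV[R]_n;
  Tmin : R;
  delta : R;
  stage : 'cV[R]_n * 'cV[R]_m -> R;   (* L *)
  terminal : 'cV[R]_n -> R }.         (* q *)

Section Problem.
Context (R : realType) (n m : nat) (p : problem R n m).

Definition Uset : set 'cV[R]_m :=
  [set u | forall j, umin p j 0 <= u j 0 <= umax p j 0].

(* Since the dynamics are Lipschitz in the state, x is determined by u and xt
   on [t, t + T]; it is carried along rather than reconstructed from u. *)
Definition admissible (t T : R) (xt : 'cV[R]_n)
    (u : R -> 'cV[R]_m) (x : R -> 'cV[R]_n) : Prop :=
  [/\ piecewise_continuous t (t + T) u,
      forall s, s \in `[t, t + T] -> Uset (u s),
      trajectory (dyn p) t (t + T) u x,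
      x t = xt
    & Omega p (x (t + T))].

Definition stage_int (a b : R) (u : R -> 'cV[R]_m) (x : R -> 'cV[R]_n) : R :=
  \int[lebesgue_measure]_(s in `[a, b]) stage p (x s, u s).

Record candidate := Candidate {
  horizon : R;
  control : R -> 'cV[R]_m;
  state_traj : R -> 'cV[R]_n }.

Definition cost (eps rho t : R) (z : candidate) : R :=
  horizon z
  + eps * stage_int t (t + horizon z) (control z) (state_traj z)
  + rho * terminal p (state_traj z (t + horizon z)).

Definition feasible (t : R) (xt : 'cV[R]_n) (z : candidate) : Prop :=
  Tmin p <= horizon z /\
  admissible t (horizon z) xt (control z) (state_traj z).

Definition solves (eps rho t : R) (xt : 'cV[R]_n) (z : candidate) : Prop :=
  feasible t xt z /\
  forall z', feasible t xt z' -> cost eps rho t z <= cost eps rho t z'.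

Definition asymptotically_controllable : Prop :=
  forall (x0 : 'cV[R]_n) (eta : R), 0 < eta ->
    exists (TD : R) (u : R -> 'cV[R]_m) (x : R -> 'cV[R]_n),
      [/\ 0 <= TD, admissible 0 TD x0 u x & enorm (x TD) < eta].

(* d/dtau q(x_s) is required only where x_s is differentiable, that is, outside
   a finite set of times. *)
Definition local_decrease : Prop :=
  forall xi0, Omega p xi0 ->
    exists (us : R -> 'cV[R]_m) (xs : R -> 'cV[R]_n),
      [/\ piecewise_continuous 0 (delta p) us,
          forall tau, tau \in `[0, delta p] -> Uset (us tau),
          trajectory (dyn p) 0 (delta p) us xs /\ xs 0 = xi0,
          forall tau, tau \in `[0, delta p] -> Omega p (xs tau)
        & exists s : seq R,
            forall tau, tau \in `]0, delta p[ -> tau \notin s ->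
              exists2 dq : R, is_derive tau 1 (terminal p \o xs) dq &
                dq + stage p (xs tau, us tau) <= 0].

End Problem.

Record parameters (R : realType) (n : nat) := MkParameters {
  Bset : set 'cV[R]_n;
  cbound : R;   (* c *)
  alpha : R;
  xi : R;
  gamma : R;
  rho0 : R }.

(* The data with which Step 2 is entered: the index i, the measured state at
   time t_i = i * delta, and the current weights. *)
Record config (R : realType) (n : nat) := Config {
  idx : nat;
  state : 'cV[R]_n;
  weps : R;
  wrho : R }.

Section Algorithm.
Context (R : realType) (n m : nat).
Context (p : problem R n m) (a : parameters R n).

Definition sampling_time (i : nat) : R := i%:R * delta p.

Definition solves_at (s : config R n) (z : candidate R n m) : Prop :=
  solves p (weps s) (wrho s) (sampling_time (idx s)) (state s) z.

Definition value_at (s : config R n) (z : candidate R n m) : R :=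
  cost p (weps s) (wrho s) (sampling_time (idx s)) z.

(* Numerator (without the factor 1 - xi) and denominator of the weight
   increment. *)
Definition eps_num (s : config R n) (z : candidate R n m) : R :=
  let t := sampling_time (idx s) in
  (if Tmin p + delta p <= horizon z then delta p else horizon z - Tmin p)
  + weps s * stage_int p t (t + delta p) (control z) (state_traj z).

Definition eps_den (s : config R n) (z : candidate R n m) : R :=
  let t := sampling_time (idx s) in
  stage_int p (t + delta p) (t + horizon z) (control z) (state_traj z)
  + (if Tmin p + delta p <= horizon z then 0
     else terminal p (state_traj z (t + horizon z))).

Definition next_state (s : config R n) (z : candidate R n m) : 'cV[R]_n :=
  state_traj z (sampling_time (idx s).+1).

(* When the quotient defining the increment has denominator 0 the new weight is
   left unspecified in [eps_i, 1]; this covers both the reading "+oo" (new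
   weight 1) and the reading "0" (weight unchanged). *)
Definition eps_update (s : config R n) (z : candidate R n m) (eps' : R) :
    Prop :=
  [/\ Bset a (next_state s z) -> eps_den s z != 0 ->
        eps' = Num.min (weps s + (1 - xi a) * (eps_num s z / eps_den s z)) 1,
      Bset a (next_state s z) -> eps_den s z = 0 -> weps s <= eps' <= 1
    & ~ Bset a (next_state s z) -> eps' = weps s].

(* One pass through Step 2, with solution z, ending at the next entry into
   Step 2. *)
Variant step (s : config R n) (z : candidate R n m) : config R n -> Prop :=
| raise_rho of solves_at s z & alpha a < value_at s z / (wrho s * cbound a) :
    step s z (Config (idx s) (state s) (weps s) (gamma a * wrho s))
| choose_eps eps' of solves_at s z
    & value_at s z / (wrho s * cbound a) <= alpha a
    & horizon z = Tmin p /\ weps s = 0 & 0 < eps' < 1 :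
    step s z (Config (idx s) (state s) eps' (wrho s))
| apply_control eps' of solves_at s z
    & value_at s z / (wrho s * cbound a) <= alpha a
    & ~ (horizon z = Tmin p /\ weps s = 0) & eps_update s z eps' :
    step s z (Config (idx s).+1 (next_state s z) eps' (wrho s)).

Definition init (x0 : 'cV[R]_n) : config R n := Config 0 x0 0 (rho0 a).

(* Configurations at which the algorithm started in x0 may pose the problem. *)
Inductive posed (x0 : 'cV[R]_n) : config R n -> Prop :=
| posed_init : posed x0 (init x0)
| posed_step s z s' : posed x0 s -> step s z s' -> posed x0 s'.

Definition run (x0 : 'cV[R]_n) (s : nat -> config R n)
    (z : nat -> candidate R n m) : Prop :=
  s 0%N = init x0 /\ forall k, step (s k) (z k) (s k.+1).

(* In particular every sampling index is reached and left, so that the loops in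
   Step 2 terminate; xs is then determined on [0, +oo). *)
Definition closed_loop (s : nat -> config R n) (z : nat -> candidate R n m)
    (xs : R -> 'cV[R]_n) : Prop :=
  forall i, exists k,
    [/\ idx (s k) = i, idx (s k.+1) = i.+1
      & forall t, t \in `[sampling_time i, sampling_time i.+1[ ->
          xs t = state_traj (z k) t].

End Algorithm.

(* Main.v *)
Require Import Defs.
From HB Require Import structures.
From mathcomp Require Import all_boot all_order all_algebra.
From mathcomp Require Import all_classical all_reals all_analysis.
From mathcomp Require Import measurable_realfun ring lra.
Import Order.TTheory GRing.Theory Num.Theory.
Import numFieldNormedType.Exports.
Local Open Scope classical_set_scope.
Local Open Scope ring_scope.
Set Implicit Arguments.
Unset Strict Implicit.
Unset Printing Implicit Defensive.

(** The optimal value is a Lyapunov function of the closed loop.  Let z be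
    optimal at t_i with final time T.  Its tail on [t_i + delta, t_i + T]
    competes at t_{i+1} when T >= Tmin + delta; otherwise it is too short, and
    it is prolonged by Tmin - (T - delta), a number in (0, delta], with the
    control of the local decrease assumption, along which the drop of q pays
    for the running cost.  The increment of the weight eps is chosen so that
    raising eps spends at most the fraction 1 - xi of what is gained, whence
    V_{i+1} <= V_i - xi num_i with num_i the numerator of the increment
    ([apply_descent]).

    The loops of Step 2 end.  Asymptotic controllability, prolonged by local
    controls up to a final time at least Tmin, provides feasible candidates
    with terminal cost as small as desired, so V / (rho c) <= alpha after
    finitely many increases of rho ([run_accepts]).  The descent preserves this
    inequality, so rho can increase again only after eps has left 0, which
    happens once; from some step on every pass applies a control and rho is
    constant ([eventually_applied]).

    The weight eps does become positive ([weps_eventually_gt0]).  If it stayed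
    at 0, Step 2b would impose T > Tmin at each of these passes.  If moreover
    T < Tmin + delta / 2, the prolongation lasts at least delta / 2 and its
    running cost is gained as well.  That gain is bounded below because the
    terminal state stays away from 0: near 0 the minimum of q at 0 makes the
    derivative of q vanish and f is bounded, so stopping h earlier would save
    the time h and change rho q by o(h) only ([minimal_horizon_near0]).  Then V
    would drop by a fixed amount forever.

    With eps >= e > 0, the descent and V >= 0 force the running cost over the
    sampling intervals to tend to 0 ([stage_cost_vanishes]).  Along controlled
    trajectories ln (1 + |x|^2) is Lipschitz in time, uniformly in the control
    ([ln_sqnorm_lipschitz]), so that a visit outside a ball lasts a definite
    time outside a smaller ball and costs a definite amount ([dwell_cost]).
    Hence the closed-loop trajectory tends to 0. *)

(** * Functions of time regular off a finite set *)

(** Piecewise continuous controls leave finitely many times at which nothing is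
    known of the derivative; the mean value theorem is used between them, by
    induction on their list. *)
Lemma nonincreasing_off_finite (R : realType) (F : R -> R) (s : seq R)
    (a b : R) : a <= b -> {within `[a, b], continuous F} ->
  (forall t, t \in `]a, b[ -> t \notin s ->
     exists2 d, is_derive t 1 F d & d <= 0) ->
  F b <= F a.
Proof.
elim: s a b => [|y s IH] a b ab cF dF.
  apply: (@ler0_derive1_le_cc _ F a b) => //.
  - by move=> t tab; have [d Fd _] := dF t tab isT; case: Fd.
  - move=> t tab; have [d Fd d0] := dF t tab isT.
    by rewrite derive1E; case: Fd => _ ->.
  - by rewrite in_itv/= lexx ab.
  - by rewrite in_itv/= lexx ab.
have [yab|yab] := boolP (y \in `]a, b[).
  have := yab; rewrite in_itv/= => /andP[ay yb].
  apply: (@le_trans _ _ (F y)).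
    apply: IH; first exact: ltW.
      apply: continuous_subspaceW cF; apply: subset_itvScc;
        by rewrite ?bnd_simp ?ltW.
    move=> t; rewrite in_itv/= => /andP[yt tb] ts; apply: dF.
      by rewrite in_itv/= tb (lt_trans ay).
    by rewrite in_cons negb_or ts gt_eqF.
  apply: IH; first exact: ltW.
    apply: continuous_subspaceW cF; apply: subset_itvScc;
      by rewrite ?bnd_simp ?ltW.
  move=> t; rewrite in_itv/= => /andP[yt tb] ts; apply: dF.
    by rewrite in_itv/= yt (lt_trans tb).
  by rewrite in_cons negb_or ts lt_eqF.
apply: IH => // t tab ts; apply: dF => //.
rewrite in_cons negb_or ts andbT; apply: contraNneq yab => <-.
exact: tab.
Qed.

Lemma lipschitz_off_finite (R : realType) (F : R -> R) (M : R) (s : seq R)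
    (a b : R) : a <= b -> {within `[a, b], continuous F} ->
  (forall t, t \in `]a, b[ -> t \notin s ->
     exists2 d, is_derive t 1 F d & `|d| <= M) ->
  `|F b - F a| <= M * (b - a).
Proof.
move=> ab cF dF.
have cM : {within `[a, b], continuous (fun t : R => M * t)}.
  by apply: continuous_subspaceT => t; apply: cvgM; [exact: cvg_cst|].
have dM (t : R) : is_derive t 1 (fun t : R => M * t) M.
  by rewrite -[M in X in is_derive _ _ _ X]mulr1; exact: is_deriveZ.
rewrite ler_norml; apply/andP; split.
- have : (fun t => - F t - M * t) b <= (fun t => - F t - M * t) a.
    apply: (@nonincreasing_off_finite _ (fun t => - F t - M * t) s) => //.
      by move=> t; apply: cvgB; [apply: cvgN; exact: cF|exact: cM].
    move=> t tab ts; have [d Fd dM0] := dF t tab ts.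
    exists (- d - M); first exact: (@is_deriveB _ _ _ (- F) (fun t => M * t)).
    by move: dM0; rewrite ler_norml => /andP[]; lra.
  by lra.
- have : (fun t => F t - M * t) b <= (fun t => F t - M * t) a.
    apply: (@nonincreasing_off_finite _ (fun t => F t - M * t) s) => //.
      by move=> t; apply: cvgB; [exact: cF|exact: cM].
    move=> t tab ts; have [d Fd dM0] := dF t tab ts.
    exists (d - M); first exact: (@is_deriveB _ _ _ F (fun t => M * t)).
    by move: dM0; rewrite ler_norml => /andP[]; lra.
  by lra.
Qed.

Lemma measurable_off_finite (R : realType) (g : R -> R) (s : seq R) (a b : R) :
  (forall t, t \in `]a, b[ -> t \notin s -> {for t, continuous g}) ->
  measurable_fun `[a, b] g.
Proof.
move=> cg.
pose A := `]a, b[%classic `&` ~` [set` s].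
pose B := `[a, b]%classic `&` ([set a; b] `|` [set` s]).
have oA : open A.
  apply: openI; first exact: interval_open.
  by rewrite openC; apply: compact_closed => //; apply: finite_compact;
    exact: finite_seq.
have finB : finite_set B.
  by apply: finite_setIr; rewrite finite_setU; split;
    [exact: finite_set2|exact: finite_seq].
have abE : `[a, b]%classic = A `|` B.
  apply/seteqP; split => t /=.
    rewrite in_itv/= => /andP[at_ tb].
    have [ts|ts] := boolP (t \in s).
      by right; split => /=; [rewrite in_itv/= at_|right].
    have [->|ta] := eqVneq t a.
      by right; split => /=; [rewrite in_itv/= lexx (le_trans at_ tb)|left;left].
    have [->|tb'] := eqVneq t b.
      by right; split => /=; [rewrite in_itv/= lexx (le_trans at_ tb)|left;right].
    left; split => /=; last exact/negP.
    by rewrite in_itv/= !lt_neqAle at_ tb tb' eq_sym ta.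
  case=> [[]|[]//] /=; rewrite !in_itv/= => /andP[/ltW -> /ltW ->]//.
rewrite abE; apply/measurable_funU.
- exact: open_measurable.
- exact: countable_measurable (finite_set_countable finB).
split.
  apply: open_continuous_measurable_fun => // t /set_mem[tab /negP ts].
  exact: cg.
move=> _ Y mY; apply: countable_measurable => [t|]; first exact: measurable_set1.
by apply: finite_set_countable; exact: finite_setIl.
Qed.

(** * The Euclidean norm of column vectors *)

Section Euclidean.
Context {R : realType} {n : nat}.
Implicit Types x y : 'cV[R]_n.

Definition sqnorm x : R := \sum_j x j 0 ^+ 2.

Lemma sqnorm_ge0 x : 0 <= sqnorm x.
Proof. by apply: sumr_ge0 => j _; exact: sqr_ge0. Qed.

Lemma enorm_sqr x : enorm x ^+ 2 = sqnorm x.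
Proof.
have E : (x^T *m 1%:M *m x) 0 0 = sqnorm x.
  by rewrite mulmx1 mxE; apply: eq_bigr => j _; rewrite mxE expr2.
by rewrite /enorm /normH E sqr_sqrtr// sqnorm_ge0.
Qed.

Lemma enorm_ge0 x : 0 <= enorm x.
Proof. exact: sqrtr_ge0. Qed.

Lemma sqnormD x y : sqnorm (x + y) <= 2 * sqnorm x + 2 * sqnorm y.
Proof.
rewrite /sqnorm !mulr_sumr -big_split; apply: ler_sum => j _ /=.
by rewrite mxE; have := sqr_ge0 (x j 0 - y j 0); nra.
Qed.

Lemma norm_cvP x (e : R) : 0 <= e ->
  reflect (forall j, `|x j 0| <= e) (`|x| <= e).
Proof.
move=> e0; apply: (iffP idP) => [xe j|xe].
  apply: le_trans xe; rewrite [leRHS]/Num.Def.normr/= mx_normrE.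
  exact: (le_bigmax _ _ (j, ord0)).
rewrite [leLHS]/Num.Def.normr/= mx_normrE; apply/bigmax_leP; split=> //.
by case=> i k _ /=; rewrite (ord1 k).
Qed.

Lemma norm_le_enorm x : `|x| <= enorm x.
Proof.
apply/norm_cvP; first exact: enorm_ge0.
move=> j; rewrite -(@ler_sqr _ `|x j 0|) ?nnegrE ?enorm_ge0//.
rewrite enorm_sqr real_normK ?num_real// /sqnorm (bigD1 j)//= lerDl.
by apply: sumr_ge0 => i _; exact: sqr_ge0.
Qed.

Lemma continuous_sqnorm : continuous (sqnorm : 'cV[R]_n -> R).
Proof.
apply: (@continuous_big R^o _ +%R 0) => [|j _ x].
  by move=> z; apply: cvgD; [exact: cvg_fst|exact: cvg_snd].
apply: (@continuous_comp _ _ _ (fun x : 'cV[R]_n => x j 0) (fun r => r ^+ 2)).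
  exact: coord_continuous.
exact: exprn_continuous.
Qed.

(** It is the transpose of a box of row vectors, compact by Tychonoff. *)
Lemma compact_cV_box (A : 'I_n -> set R) : (forall j, compact (A j)) ->
  compact [set x : 'cV[R]_n | forall j, A j (x j 0)].
Proof.
move=> cA; have cB := rV_compact cA.
have -> : [set x : 'cV[R]_n | forall j, A j (x j 0)] =
    trmx @` [set v : 'rV[R]_n | forall i, A i (v ord0 i)].
  apply/seteqP; split => [x Ax|_ [v Av <-] j] /=; last by rewrite mxE.
  by exists x^T; rewrite ?trmxK// => i /=; rewrite mxE.
apply: continuous_compact cB; apply: continuous_subspaceT => v.
apply/(@cvgrPdist_le _ _ _ (nbhs v)) => e e0; near=> w.
apply/norm_cvP; first exact: ltW.
move=> j; have -> : (v^T - w^T) j 0 = (v - w) 0 j by rewrite !mxE.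
have : `|v - w| <= e by near: w; apply: (@cvgr_dist_le _ _ _ (nbhs v)) => //; exact: cvg_id.
apply: le_trans; rewrite [leRHS]/Num.Def.normr/= mx_normrE.
exact: (le_bigmax _ _ (ord0, j)).
Unshelve. all: by end_near. Qed.

Lemma is_derive_sqnorm (x : R -> 'cV[R]_n) (t : R) (d : 'cV[R]_n) :
  is_derive t 1 x d ->
  is_derive t 1 (fun s => sqnorm (x s)) (\sum_j 2 * x t j 0 * d j 0).
Proof.
move=> [dx xd].
have dxj j : is_derive t 1 (fun s => x s j 0) (d j 0).
  split; first exact: (proj1 (derivable_mxP _ _ _) dx j 0).
  by rewrite -xd derive_mx// mxE.
have -> : (fun s => sqnorm (x s)) = \sum_j (fun s => x s j 0 ^+ 2).
  by apply/funext => s; rewrite fct_sumE.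
have -> : \sum_j 2 * x t j 0 * d j 0 =
    \sum_j ((2%:R * x t j 0 ^+ 1) *: d j 0 : R) by [].
apply: (@is_derive_sum _ _ R^o _ (fun j s => x s j 0 ^+ 2)) => j.
exact: (@is_deriveX _ _ (fun s => x s j 0) 2 _ _ _ (dxj j)).
Qed.

End Euclidean.

Lemma continuous_pairr (R : realType) (n m : nat) (x : 'cV[R]_n) :
  continuous (fun u : 'cV[R]_m => (x, u)).
Proof.
move=> u.
exact: (@cvg_pair _ _ _ (nbhs u) (nbhs x) (nbhs u) (nbhs_filter u)
  (nbhs_filter x) (nbhs_filter u) (fun=> x) id
  (@cvg_cst _ x _ (nbhs u) (nbhs_filter u)) (@cvg_id _ (nbhs u))).
Qed.

(** * Restricting, shifting and pasting functions of time *)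

Section Pieces.
Context {R : realType} {W : normedModType R}.
Implicit Types (u v x y : R -> W).

Lemma near_eq_is_cvg (F : set_system R) u v : Filter F ->
  (\forall t \near F, u t = v t) -> cvg (u @ F) -> cvg (v @ F).
Proof.
move=> FF uv /cvg_ex[l ul]; apply/cvg_ex; exists l.
by apply: cvg_trans ul; apply: near_eq_cvg; apply: filterS uv => t ->.
Qed.

Lemma near_eq_continuous_at u v (t : R) : (\forall r \near t, u r = v r) ->
  {for t, continuous u} -> {for t, continuous v}.
Proof.
move=> uv; rewrite /prop_for /continuous_at -(nbhs_singleton uv) => cu.
by apply: cvg_trans cu; apply: near_eq_cvg; apply: filterS uv => r ->.
Qed.

Lemma is_derive_shiftr x (c t : R) (d : W) :
  is_derive (t - c) 1 x d -> is_derive t 1 (fun s => x (s - c)) d.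
Proof.
have E : (fun h : R => h^-1 *: (x (h *: (1 : R) + t - c) - x (t - c))) =
         (fun h : R => h^-1 *: (x (h *: (1 : R) + (t - c)) - x (t - c))).
  by apply/funext => h; rewrite addrA.
by case=> dx xd; split; [rewrite /derivable/= E | rewrite /derive/= E].
Qed.

Lemma at_right_shiftr x (c t : R) :
  (fun s => x (s - c)) @ t^'+ = x @ (t - c)^'+.
Proof.
apply/funext => A; apply/propext.
suff : (\forall s \near t^'+, A (x (s - c))) <->
       (\forall s \near (t - c)^'+, A (x s)) by [].
rewrite nbhs_right0P [X in _ <-> X]nbhs_right0P.
by split; apply: filterS => e; rewrite addrAC.
Qed.

Lemma at_left_shiftr x (c t : R) :
  (fun s => x (s - c)) @ t^'- = x @ (t - c)^'-.
Proof.
apply/funext => A; apply/propext.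
suff : (\forall s \near t^'-, A (x (s - c))) <->
       (\forall s \near (t - c)^'-, A (x s)) by [].
rewrite nbhs_left0P [X in _ <-> X]nbhs_left0P.
by split; apply: filterS => e; rewrite addrAC.
Qed.

Lemma within_continuous_shiftr x (a b c : R) :
  {within `[a, b], continuous x} ->
  {within `[a + c, b + c], continuous (fun s => x (s - c))}.
Proof.
move=> /subspace_continuousP cx; apply/subspace_continuousP => t.
rewrite /= in_itv/= => tab.
have tcab : t - c \in `[a, b] by rewrite in_itv/=; lra.
have := cx _ tcab; apply: cvg_trans => A /=.
suff : (\forall s \near t - c, s \in `[a, b] -> A (x s)) ->
       (\forall s \near t, s \in `[a + c, b + c] -> A (x (s - c))) by [].
rewrite (near_shift t); apply: filterS => s /=.
have -> : s + (t - c - t) = s - c by ring.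
move=> h sab.
by apply: h; move: sab; rewrite !in_itv/=; lra.
Qed.

Lemma piecewise_continuous_shift u (a b c : R) :
  piecewise_continuous a b u ->
  piecewise_continuous (a + c) (b + c) (fun s => u (s - c)).
Proof.
move=> [[s cu] ru lu]; split.
- exists [seq r + c | r <- s] => t tab ts.
  have cut : {for t - c, continuous u}.
    apply: cu; first by move: tab; rewrite !in_itv/=; lra.
    by apply: contra ts => ts; apply/mapP; exists (t - c); rewrite ?subrK.
  apply: (@continuous_comp _ _ _ (fun s => s - c) u) => //.
  by apply: cvgB; [exact: cvg_id|exact: cvg_cst].
- by move=> t tab; rewrite at_right_shiftr; apply: ru; move: tab;
    rewrite !in_itv/=; lra.
- by move=> t tab; rewrite at_left_shiftr; apply: lu; move: tab;
    rewrite !in_itv/=; lra.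
Qed.

Lemma piecewise_continuous_sub u (a b c d : R) : a <= c -> d <= b ->
  piecewise_continuous a b u -> piecewise_continuous c d u.
Proof.
move=> ac db [[s cu] ru lu]; split.
- exists s => t tcd; apply: cu; move: tcd; rewrite !in_itv/=; lra.
- by move=> t tcd; apply: ru; move: tcd; rewrite !in_itv/=; lra.
- by move=> t tcd; apply: lu; move: tcd; rewrite !in_itv/=; lra.
Qed.

Definition paste u v (c t : R) : W := if t <= c then u t else v t.

Lemma paste_near_lt u v (c t : R) : t < c ->
  \forall r \near t, u r = paste u v c r.
Proof.
move=> tc; near=> r; rewrite /paste ifT//.
by apply/ltW; near: r; exact: lt_nbhsl.
Unshelve. all: by end_near. Qed.

Lemma paste_near_gt u v (c t : R) : c < t ->
  \forall r \near t, v r = paste u v c r.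
Proof.
move=> tc; near=> r; rewrite /paste leNgt ifF//; apply: negbF.
by near: r; exact: lt_nbhsr.
Unshelve. all: by end_near. Qed.

Lemma piecewise_continuous_paste u v (a c b : R) : a <= c -> c <= b ->
  piecewise_continuous a c u -> piecewise_continuous c b v ->
  piecewise_continuous a b (paste u v c).
Proof.
move=> ac cb [[s cu] ru lu] [[s' cv] rv lv]; split.
- exists (c :: s ++ s') => t; rewrite in_itv/= => /andP[at_ tb].
  rewrite in_cons mem_cat !negb_or => /and3P[tc ts ts'].
  case: (ltgtP t c) tc => // tc _.
    apply: near_eq_continuous_at (cu _ _ ts); last by rewrite in_itv/= at_.
    exact: paste_near_lt.
  apply: near_eq_continuous_at (cv _ _ ts'); last by rewrite in_itv/= tc.
  exact: paste_near_gt.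
- move=> t; rewrite in_itv/= => /andP[at_ tb]; have [tc|ct] := ltP t c.
    apply: near_eq_is_cvg (ru t _); last by rewrite in_itv/= at_.
    by apply: (@cvg_within _ (nbhs t)); exact: paste_near_lt.
  apply: near_eq_is_cvg (rv t _); last by rewrite in_itv/= ct.
  near=> r; rewrite /paste leNgt ifF//; apply: negbF.
  apply: (le_lt_trans ct); near: r; exact: nbhs_right_gt.
- move=> t; rewrite in_itv/= => /andP[at_ tb]; have [tc|ct] := leP t c.
    apply: near_eq_is_cvg (lu t _); last by rewrite in_itv/= at_.
    near=> r; rewrite /paste ifT//.
    rewrite (le_trans _ tc)//; apply/ltW; near: r; exact: nbhs_left_lt.
  apply: near_eq_is_cvg (lv t _); last by rewrite in_itv/= ct.
  by apply: (@cvg_within _ (nbhs t)); exact: paste_near_gt.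
Unshelve. all: by end_near. Qed.

Lemma within_continuous_paste x y (a c b : R) : a <= c -> c <= b ->
  x c = y c -> {within `[a, c], continuous x} ->
  {within `[c, b], continuous y} ->
  {within `[a, b], continuous (paste x y c)}.
Proof.
move=> ac cb xyc cx cy.
have -> : `[a, b]%classic = `[a, c]%classic `|` `[c, b]%classic.
  apply/seteqP; split => t /=; rewrite !in_itv/=.
    by case/andP => at_ tb; have [tc|ct] := leP t c; [left|right];
      rewrite ?at_ ?tb ?(ltW ct).
  by case=> /andP[h1 h2]; apply/andP; split; lra.
apply: withinU_continuous; [exact: itv_closed|exact: itv_closed| |].
  apply: subspace_eq_continuous cx => t /set_mem/=.
  by rewrite in_itv/= /paste /from_subspace => /andP[_ ->].
apply: subspace_eq_continuous cy => t /set_mem/=.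
rewrite in_itv/= /paste /from_subspace => /andP[ct _].
by case: leP => // tc; have -> : t = c by apply/eqP; rewrite eq_le tc.
Qed.

End Pieces.

(** * The chain rule along a curve, and descending sequences *)

Lemma is_derive1_diff_comp (R : realType) (V W : normedModType R)
    (q : V -> W) (x : R -> V) (t : R) (d : V) :
  differentiable q (x t) -> is_derive t 1 x d ->
  is_derive t 1 (q \o x) ('d q (x t) d).
Proof.
move=> dq [dx xd]; have diffx := proj1 (derivable1_diffP _ _) dx.
split; first by apply/derivable1_diffP; exact: differentiable_comp.
have dqx : differentiable (q \o x) t by exact: differentiable_comp.
by rewrite (deriveE _ dqx) diff_comp//= -(deriveE _ diffx) xd.
Qed.

Lemma near_zero_norm_lt (R : realType) (V W : normedModType R) (g : V -> W)
    (a : V) (e : R) : continuous g -> g a = 0 -> 0 < e ->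
  \forall x \near a, `|g x| < e.
Proof.
move=> cg ga e0; have := cg a; rewrite /continuous_at ga.
move=> /cvgr_dist_lt/(_ _ e0); apply: filterS => x.
by rewrite sub0r normrN.
Qed.

Lemma no_infinite_descent (R : realType) (v : nat -> R) (mu : R) (K : nat) :
  0 < mu -> (forall k, 0 <= v k) ->
  ~ (forall k, (K <= k)%N -> v k.+1 <= v k - mu).
Proof.
move=> mu0 v0 dv.
have key j : v (K + j)%N <= v K - j%:R * mu.
  elim: j => [|j IH]; first by rewrite addn0 mul0r subr0.
  rewrite addnS -natr1 mulrDl mul1r.
  by have := dv (K + j)%N (leq_addr _ _); lra.
have := key (Num.truncn (v K / mu)).+1.
have : v K / mu < (Num.truncn (v K / mu)).+1%:R by exact: truncnS_gt.
rewrite ltr_pdivrMr// => h.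
by have := v0 (K + (Num.truncn (v K / mu)).+1)%N; lra.
Qed.

(** A nonnegative sequence that decreases by d k at step k converges, so its
    drops tend to 0. *)
Lemma nonincreasing_drop_vanishes (R : realType) (v d : nat -> R) (e : R)
    (K : nat) :
  0 < e -> (forall k, 0 <= v k) ->
  (forall k, (K <= k)%N -> v k.+1 <= v k - d k) ->
  (forall k, (K <= k)%N -> 0 <= d k) ->
  exists K', forall k, (K' <= k)%N -> d k < e.
Proof.
move=> e0 v0 dv d0; pose w := [sequence v (j + K)%N]_j.
have wS j : w j.+1 <= w j - d (j + K)%N by apply: dv; exact: leq_addl.
have wni : nonincreasing_seq w.
  apply/nonincreasing_seqP => j; apply: le_trans (wS j) _.
  by rewrite gerBl; apply: d0; exact: leq_addl.
have wlb : has_lbound (range w) by exists 0 => _ [j _ <-]; exact: v0.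
have cw := nonincreasing_is_cvgn wni wlb.
have cw1 : [sequence w j.+1]_j @ \oo --> limn w by rewrite cvg_shiftS.
have : [sequence w j - w j.+1]_j @ \oo --> (0 : R).
  by rewrite -(subrr (limn w)); exact: cvgB cw cw1.
move=> /cvgr_lt/(_ e e0)[N _ hN]; exists (N + K)%N => k Nk.
have Kk : (K <= k)%N by apply: leq_trans Nk; exact: leq_addl.
have := hN (k - K)%N; rewrite /= leq_subRL// addnC Nk => /(_ isT).
have := wS (k - K)%N; rewrite /= subnK//; lra.
Qed.

(** * Growth of controlled trajectories *)

Section RecedingHorizon.
Context {R : realType} {n m : nat}.
Variable p : problem R n m.
Hypothesis delta_gt0 : 0 < delta p.
Hypothesis Tmin_ge : delta p <= Tmin p.
Hypothesis f_cont : continuous (dyn p).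
Hypothesis f_lip : exists K : R, forall x y u, Uset p u ->
  enorm (dyn p (x, u) - dyn p (y, u)) <= K * enorm (x - y).
Hypothesis L_cont : continuous (stage p).
Hypothesis L_ge0 : forall (x : 'cV[R]_n) (u : 'cV[R]_m), 0 <= stage p (x, u).
Hypothesis L_lower : exists2 alphaL : R -> R, class_K alphaL &
  forall (x : 'cV[R]_n) (u : 'cV[R]_m), alphaL (enorm x) <= stage p (x, u).
Hypothesis q_C1 : C1 (terminal p : _ -> R^o).
Hypothesis q_0 : terminal p 0 = 0.
Hypothesis q_ge0 : forall x, 0 <= terminal p x.
Hypothesis Omega_nbhs : \forall x \near (0 : 'cV[R]_n), Omega p x.
Hypothesis decrease : local_decrease p.
Hypothesis controllable : asymptotically_controllable p.
Let q_cont : continuous (terminal p : 'cV[R]_n -> R).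
Proof. by case: q_C1 => dq _ x; exact: differentiable_continuous (dq x). Qed.

Lemma compact_Uset : compact (Uset p).
Proof.
apply: (@compact_cV_box _ _ (fun j => `[umin p j 0, umax p j 0]%classic)) => j.
exact: segment_compact.
Qed.

(** The Lipschitz bound compares f(x, u) with f(0, u), which is bounded because
    the control set is a compact box. *)
Lemma dyn_growth : exists2 C, 0 <= C & forall x u, Uset p u ->
  sqnorm (dyn p (x, u)) <= C * (1 + sqnorm x).
Proof.
have [K lipK] := f_lip.
have [M M0 fM] : exists2 M, 0 <= M &
    forall u, Uset p u -> sqnorm (dyn p (0, u)) <= M.
  have cg : continuous (fun u => sqnorm (dyn p (0, u))).
    move=> u; apply: (@continuous_comp _ _ _ (fun u => dyn p (0, u)) sqnorm);
      last exact: continuous_sqnorm.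
    exact: (cvg_comp _ _ (@continuous_pairr R n m 0 u) (@f_cont _)).
  have := continuous_compact (continuous_subspaceT cg) compact_Uset.
  move=> /compact_bounded[N [_ HN]].
  exists (`|N| + 1) => [|u Uu]; first by rewrite addr_ge0.
  apply: le_trans (ler_norm _) _; apply: (HN (`|N| + 1)).
    by have := ler_norm N; lra.
  by exists u.
exists (2 * K ^+ 2 + 2 * M) => [|x u Uu].
  by have := sqr_ge0 K; lra.
have -> : dyn p (x, u) = (dyn p (x, u) - dyn p (0, u)) + dyn p (0, u).
  by rewrite subrK.
have := sqnormD (dyn p (x, u) - dyn p (0, u)) (dyn p (0, u)).
have : sqnorm (dyn p (x, u) - dyn p (0, u)) <= K ^+ 2 * sqnorm x.
  have := lipK x 0 u Uu; rewrite subr0 => h.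
  rewrite -!enorm_sqr -exprMn lerXn2r// nnegrE ?enorm_ge0//.
  exact: le_trans (enorm_ge0 _) h.
have := fM u Uu; have := sqr_ge0 K; have := sqnorm_ge0 x; nra.
Qed.

(** The growth bound gives |v'| <= C (1 + v) for v = |x|^2.  Taking the
    logarithm of 1 + v integrates this inequality in both directions of time at
    once, without any a priori bound on the trajectory. *)
Lemma ln_sqnorm_lipschitz : exists2 C, 0 <= C &
  forall a b u x, a <= b -> (forall t, t \in `[a, b] -> Uset p (u t)) ->
    trajectory (dyn p) a b u x ->
    `|ln (1 + sqnorm (x b)) - ln (1 + sqnorm (x a))| <= C * (b - a).
Proof.
have [C C0 fC] := dyn_growth.
exists (1 + C) => [|a b u x ab Uu [cx [s dx]]]; first by lra.
pose F t := ln (1 + sqnorm (x t)).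
apply: (@lipschitz_off_finite _ F _ s) => //.
  apply/subspace_continuousP => t tab.
  have cxt := (proj1 (subspace_continuousP _ _) cx) t tab.
  have ct : {for x t, continuous (fun y : 'cV[R]_n => ln (1 + sqnorm y))}.
    apply: (@continuous_comp _ _ _ (fun y => 1 + sqnorm y) (@ln R)).
      apply: (@continuousD R R^o _ (cst 1) sqnorm).
        exact: cst_continuous.
      exact: continuous_sqnorm.
    by apply: continuous_ln; have := sqnorm_ge0 (x t); lra.
  exact: (cvg_comp _ _ cxt ct).
move=> t tab ts; have Uut : Uset p (u t).
  by apply: Uu; move: tab; rewrite !in_itv/= => /andP[/ltW -> /ltW ->].
have dvt := is_derive_sqnorm (dx t tab ts).
set d := \sum_j _ in dvt.
have v0 := sqnorm_ge0 (x t).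
exists ((1 + sqnorm (x t))^-1 * d).
  have dv1 : is_derive t 1 (fun s => 1 + sqnorm (x s)) d.
    by rewrite -[d]add0r; exact: is_deriveD.
  have dl : is_derive (1 + sqnorm (x t)) 1 (@ln R) (1 + sqnorm (x t))^-1.
    by apply: is_derive1_ln; lra.
  exact: (@is_derive1_comp _ (@ln R) (fun s => 1 + sqnorm (x s)) _ _ _ dl dv1).
rewrite normrM gtr0_norm ?invr_gt0; last by lra.
rewrite ler_pdivrMl; last by lra.
apply: (@le_trans _ _ (sqnorm (x t) + sqnorm (dyn p (x t, u t)))); last first.
  by have := fC (x t) (u t) Uut; lra.
rewrite /d /sqnorm -big_split/=; apply: le_trans (ler_norm_sum _ _ _) _.
apply: ler_sum => j _; rewrite ler_norml; apply/andP; split.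
  by have := sqr_ge0 (x t j 0 + dyn p (x t, u t) j 0); nra.
by have := sqr_ge0 (x t j 0 - dyn p (x t, u t) j 0); nra.
Qed.

(** * Controlled trajectories and their running cost *)

Section Controlled.
Implicit Types (u v : R -> 'cV[R]_m) (x y : R -> 'cV[R]_n).

(** The part of admissibility that is stable under restriction of the time
    interval. *)
Definition controlled (a b : R) u x : Prop :=
  [/\ piecewise_continuous a b u,
      forall t, t \in `[a, b] -> Uset p (u t)
    & trajectory (dyn p) a b u x].

Lemma controlled_sub (a b c d : R) u x : a <= c -> d <= b ->
  controlled a b u x -> controlled c d u x.
Proof.
move=> ac db [pu Uu [cx [s dx]]]; split.
- exact: piecewise_continuous_sub pu.
- by move=> t tcd; apply: Uu; move: tcd; rewrite !in_itv/=; lra.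
split.
  apply: continuous_subspaceW cx => t; rewrite /= !in_itv/=; lra.
exists s => t tcd; apply: dx; move: tcd; rewrite !in_itv/=; lra.
Qed.

Lemma controlled_shift (a b c : R) u x : controlled a b u x ->
  controlled (a + c) (b + c) (fun t => u (t - c)) (fun t => x (t - c)).
Proof.
move=> [pu Uu [cx [s dx]]]; split.
- exact: piecewise_continuous_shift.
- by move=> t tcd; apply: Uu; move: tcd; rewrite !in_itv/=; lra.
split; first exact: within_continuous_shiftr.
exists [seq r + c | r <- s] => t tab ts; apply: is_derive_shiftr.
apply: dx; first by move: tab; rewrite !in_itv/=; lra.
by apply: contra ts => ts; apply/mapP; exists (t - c); rewrite ?subrK.
Qed.

Lemma controlled_paste (a c b : R) u v x y : a <= c -> c <= b ->
  x c = y c -> controlled a c u x -> controlled c b v y ->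
  controlled a b (paste u v c) (paste x y c).
Proof.
move=> ac cb xyc [pu Uu [cx [s dx]]] [pv Uv [cy [s' dy]]]; split.
- exact: piecewise_continuous_paste.
- move=> t; rewrite in_itv/= /paste => /andP[at_ tb].
  by have [tc|ct] := leP t c; [apply: Uu|apply: Uv]; rewrite in_itv/= ?at_ ?tb// ltW.
split; first exact: within_continuous_paste.
exists (c :: s ++ s') => t; rewrite in_itv/= => /andP[at_ tb].
rewrite in_cons mem_cat !negb_or => /and3P[tc ts ts'].
case: (ltgtP t c) tc => // tc _.
  rewrite {2 3}/paste (ltW tc).
  apply: near_eq_is_derive (dx _ _ ts); last by rewrite in_itv/= at_.
  exact: paste_near_lt.
rewrite {2 3}/paste leNgt tc/=.
apply: near_eq_is_derive (dy _ _ ts'); last by rewrite in_itv/= tc.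
exact: paste_near_gt.
Qed.

Lemma controlled_continuous (a b : R) u x : controlled a b u x ->
  exists s : seq R, forall t, t \in `]a, b[ -> t \notin s ->
    {for t, continuous (fun r => (x r, u r))}.
Proof.
move=> [[[s cu] _ _] _ [cx _]]; exists s => t tab ts.
have ab : a < b by move: tab; rewrite in_itv/= => /andP[]; exact: lt_trans.
have cxt := within_continuous_continuous ab cx tab.
have cut := cu t tab ts.
exact: (@cvg_pair _ _ _ (nbhs t) (nbhs (x t)) (nbhs (u t)) (nbhs_filter t)
  (nbhs_filter (x t)) (nbhs_filter (u t)) x u cxt cut).
Qed.

Lemma stage_continuous (a b : R) u x : controlled a b u x ->
  exists s : seq R, forall t, t \in `]a, b[ -> t \notin s ->
    {for t, continuous (fun r => stage p (x r, u r))}.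
Proof.
move=> /controlled_continuous[s cs]; exists s => t tab ts.
exact: (cvg_comp _ _ (cs t tab ts) (@L_cont _)).
Qed.

Lemma stage_integrable (a b : R) u x : controlled a b u x ->
  lebesgue_measure.-integrable `[a, b]
    (EFin \o (fun t => stage p (x t, u t))).
Proof.
move=> ux; have [s cs] := stage_continuous ux.
case: ux => [_ Uu [cx _]].
apply: measurable_bounded_integrable => //.
- by rewrite /= lebesgue_measure_itv/=; case: ifP => // _; rewrite ltry.
- exact: measurable_off_finite cs.
have cX := continuous_compact cx (@segment_compact _ a b).
have := continuous_compact (continuous_subspaceT L_cont)
  (compact_setX cX compact_Uset).
move=> /compact_bounded[M [Mr MB]]; exists M; split=> // N MN t tab.
apply: (MB _ MN); exists (x t, u t) => //=.
by split => /=; [exists t|exact: Uu].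
Qed.

Lemma stage_int_split (a c b : R) u x : a <= c -> c <= b ->
  controlled a b u x ->
  stage_int p a b u x = stage_int p a c u x + stage_int p c b u x.
Proof.
move=> ac cb ux; have iux := stage_integrable ux.
have := @Rintegral_itvB _ _ (BLeft a) (BRight b) c iux.
rewrite !bnd_simp => /(_ ac cb).
rewrite Rintegral_itv_obnd_cbnd.
  by rewrite /stage_int => <-; rewrite addrC subrK.
by apply: integrableS iux => //; apply: subset_itvr; rewrite bnd_simp.
Qed.

Lemma stage_int_paste_right (a c b : R) u v x y : a <= c -> c <= b ->
  x c = y c -> controlled a c u x -> controlled c b v y ->
  stage_int p c b (paste u v c) (paste x y c) = stage_int p c b v y.
Proof.
move=> ac cb xyc ux vy.
have sub : `]c, b]%classic `<=` `[c, b]%classic.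
  by apply: subset_itvr; rewrite bnd_simp.
have h := controlled_sub ac (lexx b) (controlled_paste ac cb xyc ux vy).
rewrite /stage_int -Rintegral_itv_obnd_cbnd; last first.
  exact: integrableS (stage_integrable h).
rewrite -Rintegral_itv_obnd_cbnd; last first.
  exact: integrableS (stage_integrable vy).
apply: eq_Rintegral => t /set_mem/=; rewrite in_itv/= => /andP[tc _].
by rewrite /paste leNgt tc.
Qed.

Lemma stage_int_ge0 (a b : R) u x : 0 <= stage_int p a b u x.
Proof. by apply: Rintegral_ge0. Qed.

End Controlled.

(** * Staying away from the origin is expensive *)

Lemma stage_int_sub (a b c d : R) u x : a <= c -> c <= d -> d <= b ->
  controlled a b u x -> stage_int p c d u x <= stage_int p a b u x.
Proof.
move=> ac cd db ux.
rewrite (stage_int_split ac (le_trans cd db) ux).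
rewrite (stage_int_split cd db (controlled_sub ac (lexx b) ux)).
have := stage_int_ge0 a c u x; have := stage_int_ge0 d b u x.
lra.
Qed.

(** If |x| >= eta at one time, then |x| >= r on a whole interval of length h
    around it, because ln (1 + |x|^2) cannot fall from l to below l / 2 in less
    than a definite time; there the running cost is at least alphaL r. *)
Lemma dwell_cost (eta len : R) : 0 < eta -> 0 < len ->
  exists2 kappa, 0 < kappa & forall a b u x, len <= b - a ->
    controlled a b u x ->
    (exists2 t, t \in `[a, b] & eta <= enorm (x t)) ->
    kappa <= stage_int p a b u x.
Proof.
move=> eta0 len0.
have [C C0 lip] := ln_sqnorm_lipschitz.
have [alphaL [_ aK a0] aL] := L_lower.
pose l := ln (1 + eta ^+ 2).
have l0 : 0 < l by rewrite ln_gt0// ltrDl exprn_gt0.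
(* h <= len / 2 leaves room for an interval of length h to one side. *)
have [h [h0 hlen hC]] : exists h, [/\ 0 < h, h <= len / 2 & C * h <= l / 2].
  exists (Num.min (len / 2) (l / (2 * (C + 1)))); split.
  - by rewrite lt_min !divr_gt0//; lra.
  - by rewrite ge_min lexx.
  - have : Num.min (len / 2) (l / (2 * (C + 1))) <= l / (2 * (C + 1)).
      by rewrite ge_min lexx orbT.
    rewrite ler_pdivlMr; last by lra.
    by nra.
pose r := Num.sqrt (expR (l / 2) - 1).
have er : 1 < expR (l / 2) by rewrite expR_gt1; lra.
have r0 : 0 < r by rewrite sqrtr_gt0; lra.
have ar : 0 < alphaL r by rewrite -a0 aK// in_itv/= ?lexx// ltW.
exists (h * alphaL r) => [|a b u x lab ux [t tab xt]]; first exact: mulr_gt0.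
have Lr s : s \in `[a, b] -> `|s - t| <= h -> alphaL r <= stage p (x s, u s).
  move=> sab st.
  have lst : `|ln (1 + sqnorm (x s)) - ln (1 + sqnorm (x t))| <= l / 2.
    apply: le_trans hC.
    have key s1 s2 : s1 \in `[a, b] -> s2 \in `[a, b] -> s1 <= s2 ->
        `|ln (1 + sqnorm (x s2)) - ln (1 + sqnorm (x s1))| <= C * (s2 - s1).
      rewrite !in_itv/= => s1ab s2ab s12.
      have [_ Uu tx] : controlled s1 s2 u x.
        by apply: controlled_sub ux; lra.
      exact: (lip _ _ u x s12 Uu tx).
    have [ts|st'] := leP t s.
      apply: le_trans (key _ _ tab sab ts) _; rewrite ler_wpM2l//.
      exact: le_trans (ler_norm _) st.
    rewrite distrC; apply: le_trans (key _ _ sab tab (ltW st')) _.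
    rewrite ler_wpM2l//; apply: le_trans st.
    by rewrite distrC; exact: ler_norm.
  have vt : l <= ln (1 + sqnorm (x t)).
    rewrite ler_ln ?posrE; last 2 first.
      by rewrite ltr_wpDr// sqr_ge0.
      by rewrite ltr_wpDr// sqnorm_ge0.
    by rewrite lerD2l -enorm_sqr lerXn2r// nnegrE ?enorm_ge0// ltW.
  have vs : expR (l / 2) <= 1 + sqnorm (x s).
    have v1 : 0 < 1 + sqnorm (x s) by rewrite ltr_wpDr// sqnorm_ge0.
    rewrite -[leRHS]lnK ?posrE// ler_expR.
    by move: lst; rewrite ler_norml => /andP[]; lra.
  apply: le_trans (aL _ _).
  have rs : r <= enorm (x s).
    by rewrite -ler_sqr ?nnegrE ?enorm_ge0 ?(ltW r0)// enorm_sqr sqr_sqrtr; lra.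
  move: rs; rewrite le_eqVlt => /predU1P[<-//|rs].
  by apply/ltW/aK; rewrite ?in_itv/= ?andbT ?enorm_ge0 ?(ltW r0).
have [c [cab dab ct td]] : exists c, [/\ a <= c, c + h <= b, c <= t & t <= c + h].
  move: tab; rewrite in_itv/= => /andP[at_ tb].
  by have [th|th] := leP (t + h) b; [exists t|exists (t - h)]; split; lra.
have cdh : c <= c + h by lra.
apply: le_trans (stage_int_sub cab cdh dab ux).
have -> : h * alphaL r = \int[lebesgue_measure]_(s in `[c, c + h]) (alphaL r : R).
  rewrite Rintegral_cst//= lebesgue_measure_itv/= lte_fin ltrDl h0 -EFinD/=.
  by rewrite mulrC; congr (_ * _); lra.
apply: le_Rintegral => //.
- apply: continuous_compact_integrable; first exact: segment_compact.
  by apply: continuous_subspaceT => z; exact: cvg_cst.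
- exact: (stage_integrable (controlled_sub cab dab ux)).
move=> s /=; rewrite in_itv/= => /andP[cs sd]; apply: Lr.
  by rewrite in_itv/=; lra.
by rewrite ler_norml; lra.
Qed.

(** * Prolonging a control inside the terminal set *)

Section Extension.
Implicit Types (u v : R -> 'cV[R]_m) (x y : R -> 'cV[R]_n).

(** The differential inequality, integrated: q + (running cost so far) has a
    nonpositive derivative off finitely many times. *)
Lemma local_control (c : R) (xi0 : 'cV[R]_n) : Omega p xi0 ->
  exists u x, [/\ controlled c (c + delta p) u x, x c = xi0,
    forall t, t \in `[c, c + delta p] -> Omega p (x t)
  & forall d, 0 <= d <= delta p ->
      terminal p (x (c + d)) + stage_int p c (c + d) u x <= terminal p xi0].
Proof.
move=> /decrease[us [xs [pus Uus [tus xs0] Oxs [s dqs]]]].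
have cus : controlled 0 (delta p) us xs by split.
have := controlled_shift c cus; rewrite add0r addrC.
set u := fun t => us (t - c); set x := fun t => xs (t - c) => ux.
have xc : x c = xi0 by rewrite /x subrr.
exists u, x; split => //.
  by move=> t; rewrite in_itv/= => tc; apply: Oxs; rewrite in_itv/=; lra.
move=> d /andP[d0 dd].
have ccd : c <= c + d by lra.
have uxd : controlled c (c + d) u x by apply: controlled_sub ux; lra.
have iux := stage_integrable uxd.
have [s' cs'] := stage_continuous uxd.
pose I t := stage_int p c t u x.
suff : terminal p (x (c + d)) + I (c + d) <= terminal p (x c) + I c.
  have -> : I c = 0 by rewrite /I /stage_int set_itv1 Rintegral_set1.
  by rewrite addr0 xc.
apply: (@nonincreasing_off_finite R (fun t => terminal p (x t) + I t)
  ([seq r + c | r <- s] ++ s')) => //.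
  have cI := parameterized_integral_continuous ccd iux.
  case: uxd => _ _ [/subspace_continuousP cx _].
  apply: (@within_continuousD _ _ R^o _ (terminal p \o x) I) => //.
  apply/subspace_continuousP => t tcd.
  exact: (cvg_comp _ _ (cx t tcd) (@q_cont _)).
move=> t; rewrite mem_cat negb_or in_itv/= => /andP[ct td] /andP[ts ts'].
have [dq dqE dqL] : exists2 dq, is_derive (t - c) 1 (terminal p \o xs) dq &
    dq + stage p (x t, u t) <= 0.
  apply: dqs; first by rewrite in_itv/=; lra.
  by apply: contra ts => ts; apply/mapP; exists (t - c); rewrite ?subrK.
exists (dq + stage p (x t, u t)) => //.
have dI : is_derive t 1 I (stage p (x t, u t)).
  have ctt : {for t, continuous (fun r => stage p (x r, u r))}.
    by apply: cs' => //; rewrite in_itv/= ct.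
  have [h1 h2] := continuous_FTC1_closed td iux ct ctt.
  by split; [exact: h1|rewrite -derive1E; exact: h2].
have dqx : is_derive t 1 (fun r => terminal p (x r)) dq.
  exact: (@is_derive_shiftr R R^o (terminal p \o xs) c t dq dqE).
exact: (@is_deriveD _ _ _ (fun r => terminal p (x r)) I).
Qed.

Lemma admissible_extend (t T d : R) xt u x : 0 <= T -> 0 <= d <= delta p ->
  admissible p t T xt u x ->
  exists u' x', [/\ admissible p t (T + d) xt u' x',
    forall s, s <= t + T -> u' s = u s /\ x' s = x s
  & terminal p (x' (t + (T + d))) +
    stage_int p (t + T) (t + (T + d)) u' x' <= terminal p (x (t + T))].
Proof.
move=> T0 /andP[d0 dd] [pu Uu tu xt0 xO].
have ux : controlled t (t + T) u x by [].
have [v [y [vy yT yO yq]]] := local_control (t + T) xO.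
have vyd : controlled (t + T) (t + (T + d)) v y.
  by apply: controlled_sub vy; lra.
have tT : t <= t + T by lra.
have Td : t + T <= t + (T + d) by lra.
have [pu' Uu' tu'] := controlled_paste tT Td (esym yT) ux vyd.
have x'T : paste x y (t + T) (t + (T + d)) = y (t + (T + d)).
  rewrite /paste; case: leP => // h.
  by have -> : t + (T + d) = t + T by lra.
exists (paste u v (t + T)), (paste x y (t + T)); split.
- split => //; first by rewrite /paste tT.
  by rewrite x'T; apply: yO; rewrite in_itv/=; lra.
- by move=> s sT; rewrite /paste sT.
rewrite x'T (stage_int_paste_right tT Td (esym yT) ux vyd) addrA.
by apply: yq; rewrite d0.
Qed.

(** A controllability time may be shorter than Tmin; prolongations by delta make
    up for it and do not increase the terminal cost. *)
Lemma feasible_small_terminal (t e : R) (xt : 'cV[R]_n) :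
  0 < e ->
  exists2 z, feasible p t xt z &
    terminal p (state_traj z (t + horizon z)) < e.
Proof.
move=> e0.
have [eta eta0 qe] : exists2 eta, 0 < eta &
    forall w : 'cV[R]_n, enorm w < eta -> terminal p w < e.
  have := @q_cont 0; rewrite /continuous_at q_0.
  move=> /cvgr_lt/(_ e e0)/nbhs_ballP[eta eta0 h].
  exists eta => // x xe; apply: h; rewrite -ball_normE/= sub0r normrN.
  exact: le_lt_trans (norm_le_enorm _) xe.
have [T [u0 [x0 [T0 [pu0 Uu0 tu0 x00 x0T] xe]]]] := controllable xt eta0.
have ux0 : controlled 0 (0 + T) u0 x0 by [].
have [k kT] : exists k : nat, Tmin p <= k%:R * delta p.
  exists (Num.truncn (Tmin p / delta p)).+1.
  by rewrite -ler_pdivrMr//; apply: ltW; exact: truncnS_gt.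
suff [u [x [[pu Uu tu ut xT] qx]]] : exists u x,
    admissible p t (T + k%:R * delta p) xt u x /\
    terminal p (x (t + (T + k%:R * delta p))) < e.
  by exists (Candidate (T + k%:R * delta p) u x) => //; split => //=; lra.
elim: k {kT} => [|k [u [x [ux qx]]]].
  have [pu Uu tu] : controlled t (t + (T + 0%:R * delta p))
      (fun s => u0 (s - t)) (fun s => x0 (s - t)).
    have := controlled_shift t ux0.
    by rewrite !add0r mul0r addr0 (addrC T).
  have E : t + (T + 0%:R * delta p) - t = T by ring.
  exists (fun s => u0 (s - t)), (fun s => x0 (s - t)); split.
    by split; rewrite ?subrr ?E//; rewrite -[T]add0r.
  by rewrite E; apply: qe.
have Tk : 0 <= T + k%:R * delta p by rewrite addr_ge0// mulr_ge0// ltW.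
have dd : 0 <= delta p <= delta p by rewrite lexx ltW.
have [u' [x' [ux' _ qx']]] := admissible_extend Tk dd ux.
have E : T + k.+1%:R * delta p = T + k%:R * delta p + delta p.
  by rewrite -addrA -[k.+1]addn1 natrD mulrDl mul1r.
exists u', x'; rewrite E; split => //.
apply: le_lt_trans qx; apply: le_trans qx'.
by rewrite lerDl; apply: stage_int_ge0.
Qed.

End Extension.

(** * Optimal horizons that end near the origin *)

Let q : 'cV[R]_n -> R^o := terminal p.

(** The origin minimizes q. *)
Lemma diff_terminal0 (v : 'cV[R]_n) : 'd q 0 v = 0.
Proof.
have [dq _] := q_C1.
have dx (t : R) : is_derive t 1 (fun h : R => h *: v) v.
  have [dl lE] := is_diff_scalel t v.
  split; first exact/derivable1_diffP.
  by rewrite (deriveE _ dl) lE scale1r.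
have dphi (t : R) := is_derive1_diff_comp (dq (t *: v)) (dx t).
have h0 : (0 : R) \in `]-1, 1[ by rewrite in_itv/=; lra.
have h1 : -1 <= 1 :> R by lra.
have := @derive1_at_min R (fun h => q (h *: v)) (-1) 1 0 h1 _ h0.
case=> [t _|t _|_ E].
- by case: (dphi t).
- rewrite scale0r; have -> : q 0 = 0 := q_0; exact: q_ge0.
have [_] := dphi 0.
by rewrite scale0r => <-.
Qed.

Lemma diff_terminal_small (e : R) : 0 < e ->
  \forall x \near (0 : 'cV[R]_n), forall u, Uset p u ->
    `|'d q x (dyn p (x, u))| <= e.
Proof.
move=> e0; have [dq cq] := q_C1.
have [C C0 fC] := dyn_growth.
pose tau := e / (n%:R + 2 * C + 1).
have nC : 0 < n%:R + 2 * C + 1 by have := ler0n R n; lra.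
have tau0 : 0 < tau by rewrite divr_gt0.
have near1 : \forall x \near (0 : 'cV[R]_n), sqnorm x < 1.
  have := @continuous_sqnorm R n 0; rewrite /continuous_at.
  have -> : sqnorm (0 : 'cV[R]_n) = 0.
    by apply: big1 => j _; rewrite mxE expr0n.
  by move=> /cvgr_lt/(_ 1 ltr01).
have near2 : \forall x \near (0 : 'cV[R]_n), forall j : 'I_n,
    `|'d q x (delta_mx j 0)| < tau.
  apply: (@filter_forall _ _ (fun j x => `|'d q x (delta_mx j 0)| < tau)
    _ (nbhs_filter (0 : 'cV[R]_n))) => j.
  exact: (near_zero_norm_lt (cq (delta_mx j 0)) (diff_terminal0 _) tau0).
near=> x; move=> u Uu.
have x1 : sqnorm x < 1 by near: x.
have xtau (j : 'I_n) : `|'d q x (delta_mx j 0)| < tau by move: j; near: x.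
set y := dyn p (x, u).
have -> : 'd q x y = \sum_j y j 0 * 'd q x (delta_mx j 0).
  rewrite {1}[y]matrix_sum_delta; under eq_bigr do rewrite big_ord1.
  rewrite linear_sum; apply: eq_bigr => j _.
  by rewrite linearZ.
apply: le_trans (ler_norm_sum _ _ _) _.
apply: (@le_trans _ _ (\sum_(j < n) tau * (1 + y j 0 ^+ 2))).
  apply: ler_sum => j _; rewrite normrM mulrC; apply: ler_pM => //.
    exact: ltW.
  by rewrite -real_normK ?num_real//; have := sqr_ge0 (`|y j 0| - 1); nra.
rewrite -mulr_sumr big_split/= sumr_const card_ord.
have : sqnorm y <= 2 * C by have := fC x u Uu; have := sqnorm_ge0 x; nra.
rewrite /tau mulrAC ler_pdivrMr// /sqnorm => yC.
by rewrite ler_pM2l//; lra.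
Unshelve. all: by end_near. Qed.

(** With weight 0, stopping h earlier saves h and costs at most h / 2 when the
    trajectory ends near 0; as the truncated candidate is feasible for small h,
    an optimal horizon above Tmin cannot end there. *)
Lemma minimal_horizon_near0 (rho : R) : 1 <= rho ->
  exists2 eta, 0 < eta & forall t xt z, solves p 0 rho t xt z ->
    Tmin p < horizon z -> eta <= enorm (state_traj z (t + horizon z)).
Proof.
move=> rho1.
have e0 : 0 < (2 * rho)^-1 by rewrite invr_gt0; lra.
have [eta /= eta0 near0] : exists2 eta : R, 0 < eta & forall x : 'cV[R]_n,
    `|x| < eta -> Omega p x /\
    forall u, Uset p u -> `|'d q x (dyn p (x, u))| <= (2 * rho)^-1.
  have : \forall x \near (0 : 'cV[R]_n), Omega p x /\
      forall u, Uset p u -> `|'d q x (dyn p (x, u))| <= (2 * rho)^-1.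
    exact: (filterI Omega_nbhs (diff_terminal_small e0)).
  move=> /nbhs_ballP[eta /= eta0 h].
  by exists eta => // x xe; apply: h; rewrite -ball_normE/= sub0r normrN.
exists eta => // t xt [T u x] [[/= TT [pu Uu tu xt0 xT]] opt] /= TminT.
rewrite leNgt; apply/negP => /(le_lt_trans (norm_le_enorm _)) xTe.
have ux : controlled t (t + T) u x by [].
have Tmin0 : 0 < Tmin p := lt_le_trans delta_gt0 Tmin_ge.
have T0 : 0 < T by exact: lt_trans Tmin0 TminT.
have [h [h0 hT xh]] : exists h, [/\ 0 < h, h <= T - Tmin p &
    forall s, s \in `[t + T - h, t + T] -> `|x s| < eta].
  have [/subspace_continuousP cx _] := tu.
  have tTin : t + T \in `[t, t + T] by rewrite in_itv/= lexx lerDl ltW.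
  have xe0 : 0 < eta - `|x (t + T)| by rewrite subr_gt0.
  have /cvgr_dist_lt/(_ _ xe0) := cx _ tTin.
  rewrite near_withinE => /nbhs_ballP[e /= e1 he].
  pose h := Num.min (e / 2) (T - Tmin p).
  have hE : h <= e / 2 by rewrite ge_min lexx.
  have hT : h <= T - Tmin p by rewrite ge_min lexx orbT.
  have h0 : 0 < h by rewrite lt_min divr_gt0//= subr_gt0.
  exists h; split => // s; rewrite in_itv/= => /andP[s1 s2].
  have := he s; rewrite -ball_normE/= ltr_norml.
  have -> : - e < t + T - s < e by lra.
  have -> : s \in `[t, t + T] by rewrite in_itv/=; lra.
  move=> /(_ isT isT) xs.
  have := ler_normB (x (t + T)) (x (t + T) - x s).
  by rewrite subKr; lra.
have cTh : controlled t (t + (T - h)) u x.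
  by apply: controlled_sub ux; lra.
have Thin : t + (T - h) \in `[t + T - h, t + T] by rewrite in_itv/=; lra.
have := opt (Candidate (T - h) u x); rewrite /cost/=.
rewrite !mul0r !addr0 => opt1.
have {}opt1 : T + rho * terminal p (x (t + T)) <=
    T - h + rho * terminal p (x (t + (T - h))).
  apply: opt1; split => /=; first by lra.
  case: cTh => pu' Uu' tu'; split => //.
  by have [] := near0 _ (xh _ Thin).
have [cx [s dx]] : trajectory (dyn p) (t + T - h) (t + T) u x.
  by have [] : controlled (t + T - h) (t + T) u x
    by apply: controlled_sub ux; lra.
have [dq _] := q_C1.
have qTh : `|terminal p (x (t + T)) - terminal p (x (t + T - h))| <=
    (2 * rho)^-1 * (t + T - (t + T - h)).
  apply: (@lipschitz_off_finite R (terminal p \o x) _ s); first by lra.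
    move/subspace_continuousP : cx => cx; apply/subspace_continuousP => r rtT.
    exact: (cvg_comp _ _ (cx r rtT) (differentiable_continuous (dq _))).
  move=> r rtT rs; exists ('d q (x r) (dyn p (x r, u r))).
    exact: (is_derive1_diff_comp (dq _) (dx r rtT rs)).
  have rin : r \in `[t + T - h, t + T].
    by move: rtT; rewrite !in_itv/= => /andP[/ltW -> /ltW ->].
  have [_] := near0 _ (xh _ rin); apply.
  by apply: Uu; move: rin; rewrite !in_itv/=; lra.
move: qTh; rewrite subKr ler_norml => /andP[qTh _].
have {}qTh : rho * (terminal p (x (t + T - h)) - terminal p (x (t + T))) <= h / 2.
  have -> : h / 2 = rho * ((2 * rho)^-1 * h) by field; lra.
  by rewrite ler_wpM2l//; lra.
by move: opt1; rewrite addrA; lra.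
Qed.

(** * Decrease of the optimal value when a control is applied *)

Variable a : parameters R n.
Hypothesis c_gt0 : 0 < cbound a.
Hypothesis alpha_gt0 : 0 < alpha a.
Hypothesis xi_01 : 0 < xi a < 1.
Hypothesis gamma_gt1 : 1 < gamma a.
Hypothesis rho0_ge1 : 1 <= rho0 a.

Section Descent.
Implicit Types (s : config R n) (z : candidate R n m).

Lemma sampling_timeS i : sampling_time p i.+1 = sampling_time p i + delta p.
Proof. by rewrite /sampling_time -addn1 natrD mulrDl mul1r. Qed.

Lemma eps_num_ge0 s z : Tmin p <= horizon z -> 0 <= weps s ->
  0 <= eps_num p s z.
Proof.
move=> Tz e0; apply: addr_ge0; last by rewrite mulr_ge0// stage_int_ge0.
by case: ifP => _; [exact: ltW|rewrite subr_ge0].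
Qed.

Lemma eps_den_ge0 s z : 0 <= eps_den p s z.
Proof.
by apply: addr_ge0; [exact: stage_int_ge0|case: ifP].
Qed.

Lemma eps_update_bounds s z eps' : Tmin p <= horizon z ->
  0 <= weps s <= 1 -> eps_update p a s z eps' ->
  weps s <= eps' <= 1 /\
  (eps' - weps s) * eps_den p s z <= (1 - xi a) * eps_num p s z.
Proof.
move=> Tz /andP[e0 e1] [inB inB0 outB].
have xi01 := xi_01.
have num0 := eps_num_ge0 Tz e0; have den0 := eps_den_ge0 s z.
have xinum : 0 <= (1 - xi a) * eps_num p s z by rewrite mulr_ge0//; lra.
have [B|nB] := pselect (Bset a (next_state p s z)); last first.
  by rewrite (outB nB) lexx e1 subrr mul0r.
have [d0|d0] := eqVneq (eps_den p s z) 0.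
  by rewrite d0 mulr0; split => //; exact: inB0.
have dgt0 : 0 < eps_den p s z by rewrite lt_def d0.
rewrite (inB B d0); split.
  rewrite le_min lerDl e1 ge_min lexx orbT !andbT.
  by rewrite mulr_ge0 ?divr_ge0//; lra.
have /(ler_wpM2r (ltW dgt0)) : Num.min
    (weps s + (1 - xi a) * (eps_num p s z / eps_den p s z)) 1 - weps s <=
    (1 - xi a) * (eps_num p s z / eps_den p s z).
  by rewrite lerBlDl ge_min lexx.
by rewrite -mulrA divfK.
Qed.

(** The candidate z' is the tail of z, prolonged if needed.  The last clause
    keeps the running cost of the prolongation, which the weight rho >= 1 of q
    pays for although a vanishing weight eps does not charge it. *)
Lemma apply_descent s z : solves_at p s z -> 1 <= wrho s -> 0 <= weps s ->
  exists z', [/\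
    feasible p (sampling_time p (idx s).+1) (next_state p s z) z',
    forall eps', weps s <= eps' <= 1 ->
      (eps' - weps s) * eps_den p s z <= (1 - xi a) * eps_num p s z ->
      cost p eps' (wrho s) (sampling_time p (idx s).+1) z' <=
      value_at p s z - xi a * eps_num p s z
  & weps s = 0 -> horizon z < Tmin p + delta p / 2 ->
    exists b u x, [/\ delta p / 2 <= b - (sampling_time p (idx s) + horizon z),
      controlled (sampling_time p (idx s) + horizon z) b u x,
      x (sampling_time p (idx s) + horizon z) =
        state_traj z (sampling_time p (idx s) + horizon z)
    & cost p 0 (wrho s) (sampling_time p (idx s).+1) z' <=
      value_at p s z -
      stage_int p (sampling_time p (idx s) + horizon z) b u x]].
Proof.
have d0 := delta_gt0; have Td := Tmin_ge; have xi01 := xi_01.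
case: z => T u x [[/= TT adm] _] rho1 e0.
rewrite /next_state /value_at /cost /eps_num /eps_den sampling_timeS /=.
set t := sampling_time p (idx s) in adm *.
set eps := weps s in e0 *; set rho := wrho s in rho1 *.
have [pu Uu tu xt xT] := adm.
have ux : controlled t (t + T) u x by [].
have t1 : t <= t + delta p by lra.
have t2 : t + delta p <= t + T by lra.
have intE := stage_int_split t1 t2 ux.
have I0 := stage_int_ge0 t (t + delta p) u x.
have I1 := stage_int_ge0 (t + delta p) (t + T) u x.
have qT := q_ge0 (x (t + T)).
have uxt : controlled (t + delta p) (t + T) u x by apply: controlled_sub ux.
case: ifPn => [Tlong|]; last rewrite -ltNge => Tshort.
  have E : t + delta p + (T - delta p) = t + T by ring.
  exists (Candidate (T - delta p) u x); rewrite /= E; split.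
  - split => /=; first by lra.
    by case: uxt => pu' Uu' tu'; rewrite /admissible E.
  - move=> eps' /andP[_ _]; rewrite !addr0 intE; lra.
  - by move=> _ h; exfalso; lra.
(* The prolongation that brings the tail back to the minimal horizon. *)
pose d := Tmin p - (T - delta p).
have d01 : 0 <= d <= delta p by rewrite /d; lra.
have T0 : 0 <= T by lra.
have [u' [x' [adm' agree qx']]] :=
  admissible_extend T0 d01 adm.
have [pu' Uu' tu' _ x'T] := adm'.
have ux' : controlled t (t + (T + d)) u' x' by [].
have E : t + delta p + Tmin p = t + (T + d) by rewrite /d; ring.
have t3 : t + T <= t + (T + d) by lra.
have ux'd : controlled (t + delta p) (t + (T + d)) u' x'.
  by apply: controlled_sub ux'; lra.
have int1 : stage_int p (t + delta p) (t + (T + d)) u' x' =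
    stage_int p (t + delta p) (t + T) u x +
    stage_int p (t + T) (t + (T + d)) u' x'.
  rewrite (stage_int_split t2 t3 ux'd); congr (_ + _).
  apply: eq_Rintegral => r /set_mem/=; rewrite in_itv/= => /andP[_ rT].
  by have [-> ->] := agree r rT.
have S0 := stage_int_ge0 (t + T) (t + (T + d)) u' x'.
set S := stage_int p (t + T) (t + (T + d)) u' x' in int1 qx' S0.
set q' := terminal p (x' (t + (T + d))) in qx'.
exists (Candidate (Tmin p) u' x'); rewrite /= E int1 -/q'; split.
- split => //=; rewrite /admissible E; case: ux'd => pu1 Uu1 tu1; split => //.
  by have [] := agree (t + delta p) t2.
- move=> eps' /andP[ee e1]; rewrite intE.
  set I0' := stage_int p t _ u x in I0 *; set I1' := stage_int p _ _ u x in I1 *.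
  set qT' := terminal p _ in qT qx' *.
  have h1 : rho * (q' + S) <= rho * qT' by rewrite ler_wpM2l//; lra.
  have h2 : 0 <= (rho - eps') * S by rewrite mulr_ge0//; lra.
  have h3 : 0 <= (eps' - eps) * qT' by rewrite mulr_ge0//; lra.
  nra.
- move=> eps0 Tshort'; exists (t + (T + d)), u', x'; split.
  + by rewrite /d; lra.
  + by apply: controlled_sub ux'; lra.
  + by have [] := agree (t + T) (lexx _).
  have h1 : rho * (q' + S) <= rho * terminal p (x (t + T)).
    by rewrite ler_wpM2l//; lra.
  have h2 : 0 <= (rho - 1) * S by rewrite mulr_ge0//; lra.
  rewrite -/S eps0 !mul0r; move: h1 h2; rewrite mulrDr mulrBl mul1r; lra.
Qed.

End Descent.

(** * Runs of the algorithm *)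

Section Run.
Variable x0 : 'cV[R]_n.
Implicit Types (s : config R n) (z : candidate R n m).

Definition weights_ok s := 0 <= weps s <= 1 /\ 1 <= wrho s.

Lemma step_solves s z s' : step p a s z s' -> solves_at p s z.
Proof. by case. Qed.

Lemma step_weights s z s' : weights_ok s -> step p a s z s' ->
  weights_ok s' /\ weps s <= weps s'.
Proof.
move=> [/andP[e0 e1] r1]; have g1 := gamma_gt1.
case=> [_ _|eps' _ _ [_ ->] /andP[e'0 e'1]|eps' sz _ _ up]; rewrite /weights_ok/=.
- by rewrite e0 e1 lexx; split => //; split => //; nra.
- by rewrite (ltW e'0) (ltW e'1).
have Tz : Tmin p <= horizon z by have [[]] := sz.
have e01 : 0 <= weps s <= 1 by rewrite e0.
have [/andP[ee e'1] _] := eps_update_bounds Tz e01 up.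
by rewrite ee e'1 (le_trans e0).
Qed.

Lemma value_ge0 s z : weights_ok s -> solves_at p s z -> 0 <= value_at p s z.
Proof.
move=> [/andP[e0 e1] r1] [[Tz _] _]; have d0 := delta_gt0; have Td := Tmin_ge.
rewrite /value_at /cost; apply: addr_ge0.
  apply: addr_ge0; first by lra.
  by rewrite mulr_ge0// stage_int_ge0.
by rewrite mulr_ge0//; lra.
Qed.

Lemma posed_weights s : posed p a x0 s -> weights_ok s.
Proof.
elim=> [|{}s z s' _ ok st]; first by rewrite /weights_ok/= lexx ler01.
by have [] := step_weights ok st.
Qed.

Lemma step_exists s z : weights_ok s -> solves_at p s z ->
  exists s', step p a s z s'.
Proof.
move=> [/andP[e0 e1] r1] sz.
have [Vbig|Vsmall] := ltP (alpha a) (value_at p s z / (wrho s * cbound a)).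
  by eexists; exact: raise_rho.
have [Te|nTe] := pselect (horizon z = Tmin p /\ weps s = 0).
  by eexists; apply: (@choose_eps _ _ _ _ _ _ _ (2^-1)) => //; lra.
suff [eps' up] : exists eps', eps_update p a s z eps'.
  by eexists; exact: apply_control up.
have [B|nB] := pselect (Bset a (next_state p s z)); last first.
  by exists (weps s); split.
have [d0|d0] := eqVneq (eps_den p s z) 0.
  by exists (weps s); split=> // [_ /eqP|_ _]; rewrite ?d0// lexx.
exists (Num.min (weps s + (1 - xi a) * (eps_num p s z / eps_den p s z)) 1).
by split=> // _ E; rewrite E eqxx in d0.
Qed.

Lemma run_exists :
  (forall s, posed p a x0 s -> exists z, solves_at p s z) ->
  exists (s : nat -> config R n) (z : nat -> candidate R n m), run p a x0 s z.
Proof.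
move=> solv.
have next s : exists zs : candidate R n m * config R n,
    posed p a x0 s -> step p a s zs.1 zs.2.
  have [ps|nps] := pselect (posed p a x0 s); last first.
    by exists (Candidate 0 (fun=> 0) (fun=> 0), s).
  have [z sz] := solv _ ps; have [s' st] := step_exists (posed_weights ps) sz.
  by exists (z, s').
have [F HF] := choice next.
pose s k := iter k (fun s => (F s).2) (init a x0).
have ps k : posed p a x0 (s k).
  elim: k => [|k IH]; first exact: posed_init.
  exact: posed_step IH (HF _ IH).
by exists s, (fun k => (F (s k)).1); split => // k; exact: HF.
Qed.

Section GivenRun.
Variables (s : nat -> config R n) (z : nat -> candidate R n m).
Hypothesis runsz : run p a x0 s z.

Let V k := value_at p (s k) (z k).
Let t k := sampling_time p (idx (s k)).

Lemma run_step k : step p a (s k) (z k) (s k.+1).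
Proof. by case: runsz. Qed.

Lemma run_weights k : weights_ok (s k).
Proof.
elim: k => [|k IH]; last by have [] := step_weights IH (run_step k).
by case: runsz => -> _; rewrite /weights_ok/= lexx ler01.
Qed.

Lemma run_solves k : solves_at p (s k) (z k).
Proof. exact: step_solves (run_step k). Qed.

Lemma run_value_ge0 k : 0 <= V k.
Proof. exact: value_ge0 (run_weights k) (run_solves k). Qed.

Lemma run_weps_homo i j : (i <= j)%N -> weps (s i) <= weps (s j).
Proof.
move=> ij; rewrite -(subnKC ij); elim: (j - i)%N => [|k IH]; first by rewrite addn0.
apply: le_trans IH _; rewrite addnS.
by have [] := step_weights (run_weights (i + k)) (run_step (i + k)).
Qed.

Definition accepted k := V k / (wrho (s k) * cbound a) <= alpha a.

(** A fixed feasible candidate bounds V by A + rho q0 with q0 < alpha c / 2,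
    whereas a rejection says V > rho alpha c; both together bound rho, which
    grows by at least gamma - 1 at every rejection. *)
Lemma run_accepts k : exists2 j, (k <= j)%N & accepted j.
Proof.
apply: contrapT => rej.
have al0 := alpha_gt0; have c0 := c_gt0; have g1 := gamma_gt1.
have half0 : 0 < alpha a * cbound a / 2 by rewrite divr_gt0// mulr_gt0.
have [z0 fz0 qz0] := feasible_small_terminal (t k) (state (s k)) half0.
have raise j : s (k + j)%N = Config (idx (s k)) (state (s k)) (weps (s k))
    (wrho (s (k + j)%N)) /\ wrho (s k) + j%:R * (gamma a - 1) <= wrho (s (k + j)%N).
  elim: j => [|j [sE rE]]; first by rewrite addn0 mul0r addr0 lexx; case: (s k).
  have rej_j : ~ accepted (k + j)%N.
    by move=> acc; apply: rej; exists (k + j)%N => //; exact: leq_addr.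
  have r1 : 1 <= wrho (s (k + j)%N) by have [] := run_weights (k + j).
  rewrite addnS; case: (run_step (k + j)) => [_ _|? _ /rej_j//|? _ /rej_j//] /=.
  by rewrite sE /= -natr1; split => //; nra.
pose A := cost p (weps (s k)) 0 (t k) z0.
pose q0 := terminal p (state_traj z0 (t k + horizon z0)).
have bound j : wrho (s (k + j)%N) * (alpha a * cbound a / 2) <= A.
  have [sE _] := raise j; have [_ r1] := run_weights (k + j).
  have rej_j : ~ accepted (k + j)%N.
    by move=> acc; apply: rej; exists (k + j)%N => //; exact: leq_addr.
  have [_ /(_ z0)] := run_solves (k + j).
  have -> : sampling_time p (idx (s (k + j)%N)) = t k by rewrite sE.
  have -> : state (s (k + j)%N) = state (s k) by rewrite sE.
  move=> /(_ fz0) opt.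
  have VA : V (k + j)%N <= A + wrho (s (k + j)%N) * q0.
    apply: le_trans (_ : cost p (weps (s (k + j)%N)) (wrho (s (k + j)%N)) (t k) z0 <= _).
      by rewrite /V /value_at; have -> : sampling_time p (idx (s (k + j)%N)) = t k by rewrite sE.
    have -> : weps (s (k + j)%N) = weps (s k) by rewrite sE.
    by rewrite /A /cost mul0r addr0.
  have rq : wrho (s (k + j)%N) * q0 <= wrho (s (k + j)%N) * (alpha a * cbound a / 2).
    by rewrite ler_wpM2l ?(ltW qz0)//; lra.
  move/negP : rej_j; rewrite -ltNge ltr_pdivlMr; last by rewrite mulr_gt0//; lra.
  by nra.
pose N := (Num.truncn (A / ((gamma a - 1) * (alpha a * cbound a / 2)))).+1.
have g0 : 0 < (gamma a - 1) * (alpha a * cbound a / 2) by rewrite mulr_gt0//; lra.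
have : A / ((gamma a - 1) * (alpha a * cbound a / 2)) < N%:R by exact: truncnS_gt.
rewrite ltr_pdivrMr// => AN.
have [_ rN] := raise N; have [_ rk] := run_weights k.
have := bound N.
have : (1 + N%:R * (gamma a - 1)) * (alpha a * cbound a / 2) <=
    wrho (s (k + N)%N) * (alpha a * cbound a / 2).
  by rewrite ler_wpM2r ?(ltW half0)//; lra.
by lra.
Qed.

Definition applied k := exists eps',
  [/\ ~ (horizon (z k) = Tmin p /\ weps (s k) = 0),
      eps_update p a (s k) (z k) eps'
    & s k.+1 = Config (idx (s k)).+1 (next_state p (s k) (z k)) eps'
                 (wrho (s k))].

Lemma accepted_step k : accepted k ->
  applied k \/ weps (s k) = 0 /\ 0 < weps (s k.+1).
Proof.
rewrite /accepted /V /applied.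
case: (run_step k) => [_ h1 h2|e _ _ [_ e0] /andP[e1 _]|e _ _ nTe up] /=.
- by move: h2; rewrite leNgt h1.
- by right.
- by left; exists e.
Qed.

Lemma applied_descent k : applied k ->
  V k.+1 <= V k - xi a * eps_num p (s k) (z k).
Proof.
move=> [e [_ up sE]]; have [e01 r1] := run_weights k.
have Tz : Tmin p <= horizon (z k) by have [[]] := run_solves k.
have [ee eden] := eps_update_bounds Tz e01 up.
have e0 : 0 <= weps (s k) by case/andP: e01.
have [z' [fz' cz' _]] := apply_descent (run_solves k) r1 e0.
apply: le_trans (cz' _ ee eden).
by rewrite /V /value_at; have [_] := run_solves k.+1; rewrite sE/=; exact.
Qed.

Lemma eps_num_run_ge0 k : 0 <= xi a * eps_num p (s k) (z k).
Proof.
have [/andP[e0 _] _] := run_weights k; have xi01 := xi_01.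
have Tz : Tmin p <= horizon (z k) by have [[]] := run_solves k.
by rewrite mulr_ge0 ?eps_num_ge0//; lra.
Qed.

(** V does not increase and rho is unchanged. *)
Lemma applied_accepted k : accepted k -> applied k -> accepted k.+1.
Proof.
rewrite /accepted => acc app; apply: le_trans acc.
have := applied_descent app; have := eps_num_run_ge0 k.
case: app => [e [_ _ sE]]; rewrite sE/= => h1 h2.
have [_ r1] := run_weights k; have c0 := c_gt0.
rewrite ler_wpM2r ?invr_ge0 ?mulr_ge0//; lra.
Qed.

(** Once a pass is accepted, all later ones are applied unless Step 2b sets eps
    to a positive value.  That can be avoided by starting after eps has become
    positive, or anywhere if it never does. *)
Lemma eventually_applied : exists K, forall k, (K <= k)%N -> applied k.
Proof.
have from i : (forall k, (i <= k)%N -> ~ (weps (s k) = 0 /\ 0 < weps (s k.+1))) ->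
    exists K, forall k, (K <= k)%N -> applied k.
  move=> nochoose; have [K iK accK] := run_accepts i.
  exists K => k Kk.
  have app j : accepted (K + j)%N -> applied (K + j)%N.
    move=> /accepted_step[//|h]; exfalso; apply: (nochoose (K + j)%N _ h).
    exact: leq_trans iK (leq_addr _ _).
  have acc j : accepted (K + j)%N.
    elim: j => [|j IH]; first by rewrite addn0.
    by rewrite addnS; apply: applied_accepted IH (app _ IH).
  by rewrite -(subnKC Kk); exact: app.
have [[k ek]|none] := pselect (exists k, 0 < weps (s k)).
  apply: (from k) => j kj [ej _].
  by have := run_weps_homo kj; rewrite ej leNgt ek.
by apply: (from 0%N) => j _ [_ ej]; apply: none; exists j.+1.
Qed.

(** Otherwise V drops by min (xi delta / 2, kappa) at every late step: through
    the elapsed time if the horizon exceeds Tmin + delta / 2, through the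
    running cost of a long prolongation starting away from 0 if not. *)
Lemma weps_eventually_gt0 : exists k, 0 < weps (s k).
Proof.
apply: contrapT => none.
have e0 k : weps (s k) = 0.
  have [/andP[e0 _] _] := run_weights k; apply/eqP; rewrite eq_le e0 andbT leNgt.
  by apply/negP => h; apply: none; exists k.
have [K app] := eventually_applied.
have rhoE k : (K <= k)%N -> wrho (s k) = wrho (s K).
  move=> Kk; rewrite -(subnKC Kk); elim: (k - K)%N => [|j IH]; first by rewrite addn0.
  by rewrite addnS -IH; have [e [_ _ ->]] := app (K + j)%N (leq_addr _ _).
have d0 := delta_gt0; have xi01 := xi_01; have Td := Tmin_ge.
have [_ r1] := run_weights K.
have [eta eta0 far] := minimal_horizon_near0 r1.
have half0 : 0 < delta p / 2 by lra.
have [kappa kappa0 dwell] := dwell_cost eta0 half0.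
have mu0 : 0 < Num.min (xi a * (delta p / 2)) kappa.
  by rewrite lt_min kappa0 andbT mulr_gt0//; lra.
apply: (@no_infinite_descent _ V _ K mu0) => [|k Kk]; first exact: run_value_ge0.
have sz := run_solves k; have Tz : Tmin p <= horizon (z k) by have [[]] := sz.
have [Tlong|Tshort] := leP (Tmin p + delta p / 2) (horizon (z k)).
  apply: le_trans (applied_descent (app _ Kk)) _; rewrite lerD2l lerN2.
  rewrite ge_min; apply/orP; left; rewrite ler_wpM2l//; first by lra.
  rewrite /eps_num e0 mul0r addr0; case: ifP => _; lra.
have [e [nTe up sE]] := app _ Kk.
have TTz : Tmin p < horizon (z k).
  by rewrite lt_def Tz andbT; apply/eqP => h; apply: nTe.
have szk : solves p 0 (wrho (s K)) (t k) (state (s k)) (z k).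
  by have := sz; rewrite /solves_at e0 rhoE.
have xfar := far _ _ _ szk TTz.
have e00 : 0 <= weps (s k) by rewrite e0.
have [_ rk] := run_weights k.
have [z' [fz' _ /(_ (e0 k) Tshort)]] := apply_descent sz rk e00.
move=> [b [u [x [lb ux xE cz']]]].
have Sk : kappa <= stage_int p (t k + horizon (z k)) b u x.
  apply: (dwell _ _ _ _ lb ux); exists (t k + horizon (z k)); last by rewrite xE.
  by rewrite in_itv/= lexx -subr_ge0; apply: le_trans lb; exact: ltW.
have VS : V k.+1 <= cost p 0 (wrho (s k)) (sampling_time p (idx (s k)).+1) z'.
  have [_] := run_solves k.+1; rewrite /V /value_at e0.
  by rewrite [s k.+1]sE/=; exact.
apply: le_trans VS (le_trans cz' _); rewrite lerD2l lerN2.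
by rewrite ge_min Sk orbT.
Qed.

(** The drop of V contains xi eps times this cost, and eps is nondecreasing. *)
Lemma stage_cost_vanishes (kappa : R) : 0 < kappa ->
  exists K, forall k, (K <= k)%N ->
    stage_int p (t k) (t k + delta p) (control (z k)) (state_traj (z k)) < kappa.
Proof.
move=> kappa0; have xi01 := xi_01.
have [K app] := eventually_applied; have [j ej] := weps_eventually_gt0.
have xe0 : 0 < xi a * (weps (s j) * kappa) by rewrite !mulr_gt0//; lra.
have [K' small] := nonincreasing_drop_vanishes xe0 run_value_ge0
  (fun k Kk => applied_descent (app k Kk)) (fun k _ => eps_num_run_ge0 k).
exists (maxn K' j) => k; rewrite geq_max => /andP[Kk jk].
have := small k Kk; rewrite ltr_pM2l; last by lra.
have d0 := delta_gt0.
have Tz : Tmin p <= horizon (z k) by have [[]] := run_solves k.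
rewrite /eps_num => h.
rewrite -(ltr_pM2l ej); apply: le_lt_trans h.
apply: (@le_trans _ _ (weps (s k) * stage_int p (t k) (t k + delta p)
    (control (z k)) (state_traj (z k)))).
  by rewrite ler_wpM2r ?stage_int_ge0// run_weps_homo.
by rewrite lerDr; case: ifP => _; [exact: ltW|rewrite subr_ge0].
Qed.

Lemma run_idx k : (idx (s k) <= idx (s k.+1) <= (idx (s k)).+1)%N.
Proof. by case: (run_step k) => * /=; rewrite ?leqnn ?leqnSn. Qed.

Lemma run_idx_homo i j : (i <= j)%N -> (idx (s i) <= idx (s j))%N.
Proof.
move=> ij; rewrite -(subnKC ij); elim: (j - i)%N => [|k IH]; first by rewrite addn0.
by rewrite addnS; apply: leq_trans IH _; case/andP: (run_idx (i + k)).
Qed.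

Lemma run_leaves i : exists k, idx (s k) = i /\ idx (s k.+1) = i.+1.
Proof.
have beyond : exists k, (i < idx (s k))%N.
  have [K app] := eventually_applied.
  have idxK j : idx (s (K + j)%N) = (idx (s K) + j)%N.
    elim: j => [|j IH]; first by rewrite !addn0.
    by rewrite !addnS -IH; have [e [_ _ ->]] := app (K + j)%N (leq_addr _ _).
  by exists (K + i.+1)%N; rewrite idxK; exact: leq_addl.
case: (ex_minnP beyond) => -[|k] ik kmin; first by move: ik; case: runsz => ->.
have ki : (idx (s k) <= i)%N.
  by rewrite leqNgt; apply/negP => /kmin; rewrite ltnn.
have /andP[_ kS] := run_idx k.
have E : idx (s k) = i by apply/eqP; rewrite eqn_leq ki -ltnS (leq_trans ik).
by exists k; split => //; apply/eqP; rewrite eqn_leq ik andbT (leq_trans kS)// E.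
Qed.

Lemma truncn_sampling i (r : R) :
  r \in `[sampling_time p i, sampling_time p i.+1[ ->
  Num.truncn (r / delta p) = i.
Proof.
rewrite in_itv/= => /andP[ir ri]; have d0 := delta_gt0.
apply/eqP; rewrite truncn_eq; last first.
  by apply: divr_ge0; [apply: le_trans ir; rewrite mulr_ge0// ltW|exact: ltW].
by rewrite ler_pdivlMr// ltr_pdivrMr// ir.
Qed.

Lemma closed_loop_exists : exists xs, closed_loop p s z xs.
Proof.
have [k kP] := choice run_leaves.
exists (fun r => state_traj (z (k (Num.truncn (r / delta p)))) r) => i.
have [ki kSi] := kP i; exists (k i); split => // r /truncn_sampling ->.
by [].
Qed.

(** A late sampling interval has too small a running cost for a visit at
    distance eta from 0. *)
Lemma closed_loop_cvg (xs : R -> 'cV[R]_n) : closed_loop p s z xs ->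
  xs r @[r --> +oo] --> (0 : 'cV[R]_n).
Proof.
move=> cl; have d0 := delta_gt0; have Td := Tmin_ge.
apply/cvgrPdist_lt => eta eta0.
have [kappa kappa0 dwell] := dwell_cost eta0 d0.
have [K small] := stage_cost_vanishes kappa0.
exists (sampling_time p (idx (s K)).+1); split; first exact: num_real.
move=> r Kr; rewrite sub0r normrN.
have r0 : 0 <= r / delta p.
  by rewrite divr_ge0 ?(ltW d0)//; apply: le_trans (ltW Kr); rewrite mulr_ge0// ltW.
pose i := Num.truncn (r / delta p).
have rin : r \in `[sampling_time p i, sampling_time p i.+1[.
  rewrite in_itv/= /sampling_time -ler_pdivlMr// -ltr_pdivrMr//.
  exact: truncn_itv.
have [k [ki _ xsE]] := cl i.
have iK : (idx (s K) < i)%N by rewrite truncn_gt_nat ler_pdivlMr// ltW.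
have Kk : (K <= k)%N.
  by rewrite leqNgt; apply/negP => /ltnW/run_idx_homo; rewrite ki leqNgt iK.
rewrite (xsE _ rin); apply: le_lt_trans (norm_le_enorm _) _.
rewrite ltNge; apply/negP => far.
have [[Tz [pu Uu tu _ _]] _] := run_solves k.
have ux : controlled (t k) (t k + delta p) (control (z k)) (state_traj (z k)).
  apply: (@controlled_sub (t k) (t k + horizon (z k))) => //.
  by rewrite lerD2l; lra.
have := small k Kk; apply/negP; rewrite -leNgt.
apply: dwell ux _; first by rewrite addrAC subrr add0r.
exists r => //; move: rin; rewrite sampling_timeS /t ki !in_itv/=.
by move=> /andP[-> /ltW ->].
Qed.

End GivenRun.
End Run.

End RecedingHorizon.

Unset Implicit Arguments.

Theorem theorem4p1 (R : realType) (n m : nat)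
    (p : problem R n m) (a : parameters R n) (H : 'M[R]_n)
    (X : set 'cV[R]_n) (x0 : 'cV[R]_n)
    (* system *)
    (f_C1 : C1 (dyn p))
    (f_00 : dyn p (0, 0) = 0)
    (f_lip : exists K : R, forall x y u, Uset p u ->
       enorm (dyn p (x, u) - dyn p (y, u)) <= K * enorm (x - y))
    (u_bounds : forall j, umin p j 0 < 0 < umax p j 0)
    (Omega_closed : closed (Omega p))
    (Omega_bounded : bounded_set (Omega p))
    (Omega_sc : simply_connected (Omega p))
    (Omega_0 : Omega p 0)
    (delta_gt0 : 0 < delta p)
    (Tmin_ge : delta p <= Tmin p)
    (controllable : asymptotically_controllable p)
    (* cost *)
    (L_ge0 : forall x u, 0 <= stage p (x, u))
    (L_C1 : C1 (stage p : _ -> R^o))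
    (L_00 : stage p (0, 0) = 0)
    (L_lower : exists2 alphaL : R -> R, class_K alphaL &
       forall x u, alphaL (enorm x) <= stage p (x, u))
    (q_ge0 : forall x, 0 <= terminal p x)
    (q_C1 : C1 (terminal p : _ -> R^o))
    (q_0 : terminal p 0 = 0)
    (H_spd : spd H)
    (c_gt0 : 0 < cbound a)
    (q_lower : forall x, cbound a * normH H x ^+ 2 <= terminal p x)
    (* algorithm parameters *)
    (B_closed : closed (Bset a))
    (B_bounded : bounded_set (Bset a))
    (B_sc : simply_connected (Bset a))
    (B_0 : Bset a 0)
    (alpha_gt0 : 0 < alpha a)
    (alpha_Omega : forall x, cbound a * normH H x ^+ 2 <= alpha a -> Omega p x)
    (xi_01 : 0 < xi a < 1)
    (gamma_gt1 : 1 < gamma a)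
    (rho0_ge1 : 1 <= rho0 a)
    (* existence of solutions for initial states in X *)
    (Omega_X : Omega p `<=` X)
    (posed_X : forall s, posed p a x0 s -> X (state s))
    (X_solvable : forall i x eps rho, X x -> 0 <= eps <= 1 -> 1 <= rho ->
       exists z, solves p eps rho (sampling_time p i) x z)
    (* assumptions 1 and 2 *)
    (assumption1 : local_decrease p)
    (assumption2 : exists z, solves p 0 (rho0 a) 0 x0 z) :
  (exists s z, run p a x0 s z) /\
  forall s z, run p a x0 s z ->
    (exists xs, closed_loop p s z xs) /\
    forall xs, closed_loop p s z xs -> xs t @[t --> +oo] --> (0 : 'cV[R]_n).
Proof.
have f_cont : continuous (dyn p).
  by case: f_C1 => df _ w; exact: differentiable_continuous (df w).
have L_cont : continuous (stage p).
  by case: L_C1 => dL _ w; exact: differentiable_continuous (dL w).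
have Omega_nbhs : \forall x \near (0 : 'cV[R]_n), Omega p x.
  have q_cont : continuous (terminal p : 'cV[R]_n -> R).
    by case: q_C1 => dq _ w; exact: differentiable_continuous (dq w).
  have := @q_cont 0; rewrite /continuous_at q_0.
  move=> /cvgr_lt/(_ _ alpha_gt0); apply: filterS => x qx.
  by apply: alpha_Omega; apply: le_trans (q_lower x) (ltW qx).
have ok s : posed p a x0 s -> weights_ok s.
  exact: (posed_weights delta_gt0 L_ge0 q_ge0 xi_01 gamma_gt1 rho0_ge1).
split.
  apply: (run_exists delta_gt0 L_ge0 q_ge0 xi_01 gamma_gt1 rho0_ge1) => s ps.
  by have [e01 r1] := ok _ ps; exact: X_solvable (posed_X s ps) e01 r1.
move=> s z sz; split.
  exact: (closed_loop_exists delta_gt0 Tmin_ge L_cont L_ge0 q_C1 q_0 q_ge0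
    assumption1 controllable c_gt0 alpha_gt0 xi_01 gamma_gt1 rho0_ge1 sz).
move=> xs; exact: (closed_loop_cvg delta_gt0 Tmin_ge f_cont f_lip L_cont L_ge0
  L_lower q_C1 q_0 q_ge0 Omega_nbhs assumption1 controllable c_gt0 alpha_gt0
  xi_01 gamma_gt1 rho0_ge1 sz).
Qed.
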